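(* Let $L>0$. Consider the heat equation on $(0,L)$ $$\partial_t u=\partial_x^2u\ (t>0,\ x\in(0,L)),\qquad u(t,0)=u(t,L)=0\ (t\ge 0),\qquad u(0,\cdot)\in L^2(0,L).\qquad(\ast)$$ (i) Let $\alpha>\frac32$ and let $E\subset(0,L)$ be a subset with $c_{h_\alpha}(E)>0$. Then for each $T>0$ there is a constant $C_{obs}>0$, depending only on $T$, $L$ and $c_{h_\alpha}(E)$, such that any solution $u$ of $(\ast)$ satisfies $$\|u(T,\cdot)\|_{L^2(0,L)}\le C_{obs}\int_0^T\sup_{x\in E}|u(t,x)|\,dt .$$ (ii) For every $\varepsilon>0$ there is a subset $E_\infty\subset(0,L)$ of positive $f_\varepsilon$-Hausdorff content, $c_{f_\varepsilon}(E_\infty)>0$, where $f_\varepsilon(t)=(\log\frac1t)^{-\frac{1}{2+\varepsilon}}$, such that the inequality in (i) with $E$ replaced by $E_\infty$ fails: for every $T>0$ there is no constant $C_{obs}$ such that $\|u(T,\cdot)\|_{L^2(0,L)}\le C_{obs}\int_0^T\sup_{x\in E_\infty}|u(t,x)|\,dt$ for all solutions $u$ of $(\ast)$.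
   Context: A gauge function is a strictly increasing continuous $f:(0,\infty)\to[0,\infty)$ with $\lim_{t\to0^+}f(t)=0$. For a gauge function $f$, the $f$-Hausdorff content of $E\subset\mathbb R^d$ is $c_f(E)=\inf\{\sum_{j\ge1} f(d(B_j)):E\subset\bigcup_{j\ge1} B_j\}$, where the $B_j$ are open balls in $\mathbb R^d$ with diameter $d(B_j)$ (here $d=1$). $h_\alpha(t)=(\log\frac1t)^{-1/2}(\log\log\frac1t)^{-\alpha}$ for $0<t\le e^{-3}$. Functions such as $h_\alpha$ and $f_\varepsilon$, given by a formula only on $(0,e^{-3}]$, are understood as gauge functions on $(0,\infty)$ via a fixed extension satisfying $f(t)\sim1$ as $t\to+\infty$ (only small $t$ is relevant). *)

(* Defs.v *)
From HB Require Import structures.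
From mathcomp Require Import all_boot all_order all_algebra.
From mathcomp Require Import all_classical all_reals all_analysis.

Set Implicit Arguments.
Unset Strict Implicit.
Unset Printing Implicit Defensive.

Import Order.TTheory GRing.Theory Num.Theory.
Import numFieldNormedType.Exports.

Local Open Scope classical_set_scope.
Local Open Scope ring_scope.

(* A gauge function is defined on ]0, +oo[ only: values of [f] at nonpositive
   arguments are irrelevant. *)
Record gauge_function (R : realType) (f : R -> R) : Prop := GaugeFunction {
  gauge_ge0 : forall t : R, 0 < t -> 0 <= f t ;
  gauge_increasing : forall s t : R, 0 < s -> s < t -> f s < f t ;
  gauge_continuous : forall t : R, 0 < t -> {for t, continuous f} ;
  gauge_cvg0 : f t @[t --> 0^'+] --> (0 : R) }.

(* In dimension 1, the open ball of center [x] and radius [r > 0] is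
   ]x - r, x + r[, of diameter [2 * r]. *)
Definition hausdorff_content (R : realType) (f : R -> R) (E : set R) : \bar R :=
  ereal_inf [set s : \bar R | exists x r : nat -> R,
    [/\ forall j, 0 < r j,
        E `<=` \bigcup_j ball (x j) (r j) &
        s = (\sum_(0 <= j <oo) (f (2 * r j))%:E)%E ]].

Definition h_formula (R : realType) (alpha t : R) : R :=
  ln t^-1 `^ (- 2^-1) * ln (ln t^-1) `^ (- alpha).

Definition f_formula (R : realType) (eps t : R) : R :=
  ln t^-1 `^ (- (2 + eps)^-1).

(* [f] is a gauge function extending to ]0, +oo[ the formula [g], given on
   ]0, e^-3], with [f t ~ 1] as [t] tends to infinity. *)
Definition gauge_extension (R : realType) (g f : R -> R) : Prop :=
  [/\ gauge_function f,
      forall t : R, 0 < t -> t <= expR (- 3) -> f t = g t &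
      f t @[t --> +oo] --> (1 : R) ].

Definition L2norm (R : realType) (L : R) (v : R -> R) : \bar R :=
  'N[lebesgue_measure]_2%:E[EFin \o (v \_ `]0, L[)].

Definition in_L2 (R : realType) (L : R) (v : R -> R) : Prop :=
  v \_ `]0, L[ \in Lfun lebesgue_measure 2%:E.

(* Classical solutions, of class C^{1,2} in ]0, +oo[ x ]0, L[ and continuous up
   to the lateral boundary for positive times; the initial datum in L^2(0, L)
   is attained in the L^2 sense. These are exactly the functions given for
   positive times by the Dirichlet heat semigroup applied to [u 0]. *)
Record heat_solution (R : realType) (L : R) (u : R -> R -> R) : Prop :=
  HeatSolution {
  heat_derivable_t : forall t x : R, 0 < t -> 0 < x < L ->
    derivable (u ^~ x) t 1 ;
  heat_derivable_x : forall t x : R, 0 < t -> 0 < x < L ->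
    derivable (u t) x 1 ;
  heat_derivable_xx : forall t x : R, 0 < t -> 0 < x < L ->
    derivable (u t)^`()%classic x 1 ;
  heat_continuous_t : forall t x : R, 0 < t -> 0 < x < L ->
    {for (t, x), continuous (fun p : R * R => (u ^~ p.2)^`()%classic p.1)} ;
  heat_continuous_x : forall t x : R, 0 < t -> 0 < x < L ->
    {for (t, x), continuous (fun p : R * R => (u p.1)^`()%classic p.2)} ;
  heat_continuous_xx : forall t x : R, 0 < t -> 0 < x < L ->
    {for (t, x), continuous (fun p : R * R => (u p.1)^`(2)%classic p.2)} ;
  heat_eq : forall t x : R, 0 < t -> 0 < x < L ->
    (u ^~ x)^`()%classic t = (u t)^`(2)%classic x ;
  heat_continuous : {within [set p : R * R | 0 < p.1 /\ 0 <= p.2 <= L],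
    continuous (fun p : R * R => u p.1 p.2)} ;
  heat_boundary : forall t : R, 0 <= t -> u t 0 = 0 /\ u t L = 0 ;
  heat_initial : in_L2 L (u 0) ;
  heat_initial_cvg : L2norm L (u t \- u 0) @[t --> 0^'+] --> 0%E }.

(* [ereal_sup set0 = -oo], but a set of positive Hausdorff content is nonempty. *)
Definition observability (R : realType) (L T : R) (E : set R) (C : R) : Prop :=
  forall u : R -> R -> R, heat_solution L u ->
    (L2norm L (u T) <= C%:E *
       \int[lebesgue_measure]_(t in `]0%R, T[)
         ereal_sup [set `|u t x|%:E | x in E])%E.

(* Main.v *)
Require Import Defs.
From mathcomp Require Import all_boot all_order all_algebra.
From mathcomp Require Import all_classical all_reals all_analysis.
From mathcomp Require Import measurable_realfun ring lra zify.

Set Implicit Arguments.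
Unset Strict Implicit.
Unset Printing Implicit Defensive.

Import Order.TTheory GRing.Theory Num.Theory.
Import numFieldNormedType.Exports.

Local Open Scope classical_set_scope.
Local Open Scope ring_scope.

(** Part (i). By the maximum principle and the density of sine sums in the
    continuous functions vanishing at [0] and [L], it suffices to treat finite
    sums [v = sum_k a_k exp(-lam_k t) sin(k pi x / L)], with constants
    independent of the number of terms. A sum of the [N] first modes is
    [sin th] times a polynomial of degree [< N] in [cos th], so that Lagrange
    interpolation at [N] points of [E] bounds its coefficients by its supremum
    on [E]. If [N = 16^J], the condition on the content provides points with at
    most [16^l] of them in any ball of radius [exp(-X_l)/8], where
    [X_l = B 256^J 64^-l / J^3] for [l < J], and the cost of the interpolation
    is [exp(C N^2 / J^3)]. The high modes decay like [exp(-c N^2 t)] and a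
    telescoping argument over the times [T/J], whose gaps are of order [J^-2],
    concludes since [J^-3 << J^-2].

    Part (ii). With [N_{k+1} ~ exp(K N_k^p)] and [p = 2 + eps/2], take the set
    of the points which, for every [k], are within [exp(-N_k^p)] of the lattice
    [(L/N_k) Z]. The eigenmode of frequency [N_k] is of size [exp(-N_k^p)] on it
    and only decays like [exp(-c N_k^2 T)] in [L^2], contradicting
    observability. The content is positive because the balls with diameters
    between [L/(2N_{k+1})] and [L/(2N_k)] of a cover of small cost are too few
    to hit all the cells of level [k] inside a cell of level [k-1]: one can
    choose nested cells avoiding all the balls. *)

(** * Maximum principle *)

(** In part (i), the cost of interpolation and the gain of dissipation are both exponentials of
    [N^2]. The factor [log(1/t)^(-1/2)] of the gauge alone would give a cost [exp(C N^2)], which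
    [exp(-c N^2 t)] cannot beat on short time intervals. The iterated logarithm supplies the missing
    decay: at [t = exp(-X)] with [log X] of order [J], it lowers the gauge by [J^(-3/2)], hence the
    [X] reached for a given cost by [J^(-3)]. Taking [N] geometric makes [J] comparable to [log N],
    and the gaps [J^(-2)] have a finite sum. The base [64] of the scales lies strictly between [16]
    and [256]: being below [256], it makes the costs of the crowded balls summable over the levels;
    being above [16], it does the same for the contributions of the levels to the interpolation. In
    part (ii), [p > 2] makes the size of the mode on the set smaller than its decay for every [T],
    while [p < 2 + eps] keeps the number of balls, a power [p / (2 + eps)] of the frequency, below
    the number of cells. *)

Lemma is_derive1B (R : realType) (f g : R -> R) (x a b : R) :
  is_derive x 1 f a -> is_derive x 1 g b ->
  is_derive x 1 (fun y => f y - g y) (a - b).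
Proof. exact: is_deriveB. Qed.

Lemma is_derive1Z (R : realType) (f : R -> R) (k x a : R) :
  is_derive x 1 f a -> is_derive x 1 (fun y => k * f y) (k * a).
Proof. exact: is_deriveZ. Qed.

Lemma is_derive_quotient (R : realType) (f : R -> R) (x d e : R) :
  is_derive x 1 f d -> 0 < e ->
  exists2 delta : R, 0 < delta & forall h : R, h != 0 -> `|h| < delta ->
    `|(f (x + h) - f x) / h - d| < e.
Proof.
move=> fd e0; have : h^-1 *: ((f \o shift x) (h *: 1) - f x) @[h --> 0^'] --> d.
  by rewrite -(@derive_val _ _ _ _ _ _ _ fd); exact: (@ex_derive _ _ _ _ _ _ _ fd).
move/cvgrPdist_lt => /(_ e e0) [delta /= delta0 H]; exists delta => // h h0 hd.
have := H h; rewrite /= sub0r normrN => /(_ hd h0).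
by rewrite distrC /= /GRing.scale/= mulr1 [h + x]addrC [h^-1 * _]mulrC.
Qed.

(** The maximum in time may be reached at the final time, where only difference quotients from the
    left are controlled. *)
Lemma left_max_derive_ge0 (R : realType) (f : R -> R) (a x d : R) :
  a < x -> is_derive x 1 f d -> (forall t, a <= t <= x -> f t <= f x) -> 0 <= d.
Proof.
move=> ax fd fmax; rewrite leNgt; apply/negP => d0.
have Nd0 : 0 < - d by rewrite oppr_gt0.
have [r r0 H] := is_derive_quotient fd Nd0.
pose h := Num.min (r / 2) (x - a).
have h0 : 0 < h by rewrite lt_min divr_gt0//= subr_gt0.
have hr : h < r by rewrite gt_min; apply/orP; left; lra.
have hxa : h <= x - a by rewrite ge_min lexx orbT.
have := H (- h); rewrite oppr_eq0 gt_eqF// normrN gtr0_norm// => /(_ isT hr).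
rewrite ltr_norml => /andP[_].
rewrite invrN mulrN ltrBlDr addNr oppr_lt0 pmulr_lgt0 ?invr_gt0// subr_gt0.
by rewrite ltNge fmax//; apply/andP; split; lra.
Qed.

(** If [d > 0], then [g], which vanishes at [x], is positive just to the right of [x], and the mean
    value theorem makes [f] exceed its maximum there. *)
Lemma max_second_derivative_le0 (R : realType) (f g : R -> R) (a b x d : R) :
  a < x < b -> (forall y, a < y < b -> is_derive y 1 f (g y)) ->
  is_derive x 1 g d -> (forall y, a < y < b -> f y <= f x) -> d <= 0.
Proof.
move=> /andP[ax xb] fg gd fmax; rewrite leNgt; apply/negP => d0.
have gx0 : g x = 0.
  have fx0 : is_derive x 1 f 0.
    have x_ab : x \in `]a, b[ by rewrite in_itv/= ax.
    apply: (@derive1_at_max _ f a b x) => //; first lra.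
    by move=> t; rewrite in_itv/= => /fg fdt; apply: (@ex_derive _ _ _ _ _ _ _ fdt).
  have := fg x; rewrite ax xb => /(_ isT) fgx.
  by rewrite -(@derive_val _ _ _ _ _ _ _ fgx) (@derive_val _ _ _ _ _ _ _ fx0).
have [r r0 H] := is_derive_quotient gd d0.
pose h := Num.min (r / 2) ((b - x) / 2).
have h0 : 0 < h by rewrite lt_min !divr_gt0//= subr_gt0.
have hr : h < r by rewrite gt_min; apply/orP; left; lra.
have hxb : h < b - x by rewrite gt_min; apply/orP; right; lra.
have [c] : exists2 c, c \in `]x, x + h[ & f (x + h) - f x = g c * (x + h - x).
  apply: (@MVT _ f g); first lra.
    by move=> y; rewrite in_itv/= => /andP[xy yh]; apply: fg; apply/andP; split; lra.
  apply: derivable_within_continuous => y; rewrite in_itv/= => /andP[xy yh].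
  have fy : is_derive y 1 f (g y) by apply: fg; apply/andP; split; lra.
  exact: (@ex_derive _ _ _ _ _ _ _ fy).
rewrite in_itv/= => /andP[xc ch] fE.
have cx0 : 0 < c - x by lra.
have := H (c - x); rewrite gt_eqF// gtr0_norm// => /(_ isT).
have -> : x + (c - x) = c by lra.
have cxr : c - x < r by lra.
move=> /(_ cxr); rewrite gx0 subr0 ltr_norml => /andP[+ _].
have -> : - d < g c / (c - x) - d = (0 < g c / (c - x)) by apply/idP/idP; lra.
rewrite pmulr_lgt0 ?invr_gt0// => gc0.
have := fmax (x + h); have -> : a < x + h < b by apply/andP; split; lra.
move=> /(_ isT); have : 0 < g c * (x + h - x) by apply: mulr_gt0 => //; lra.
rewrite -fE; lra.
Qed.

(** Subtracting [eta * (t - a)] makes the equation strict: at a maximum off the parabolic boundary,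
    [wt] is at least [eta] and [wxx] is nonpositive, against [wt = wxx]. *)
Lemma heat_max_principle (R : realType) (L a b M : R)
    (w wt wx wxx : R -> R -> R) :
  {within `[a, b]%classic `*` `[0, L]%classic, continuous (fun p : R * R => w p.1 p.2)} ->
  (forall t x, a < t <= b -> 0 < x < L ->
    [/\ is_derive t 1 (w ^~ x) (wt t x), is_derive x 1 (w t) (wx t x),
        is_derive x 1 (wx t) (wxx t x) & wt t x = wxx t x]) ->
  (forall t, a <= t <= b -> w t 0 <= M /\ w t L <= M) ->
  (forall x, 0 <= x <= L -> w a x <= M) ->
  forall t x, a <= t <= b -> 0 <= x <= L -> w t x <= M.
Proof.
move=> wcont wheat wlat wini t x tab xL.
suff H eta : 0 < eta -> w t x - eta * (t - a) <= M.
  apply/ler_addgt0Pr => e e0.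
  (* The added [1] keeps the denominator positive when [a = b]. *)
  have ba1 : 0 < b - a + 1 by move: tab => /andP[]; lra.
  have := H (e / (b - a + 1)); rewrite divr_gt0// => /(_ isT).
  have : e / (b - a + 1) * (t - a) <= e.
    rewrite -mulrA ler_piMr//; first exact: ltW.
    rewrite mulrC ler_pdivrMr// mul1r; move: tab => /andP[]; lra.
  lra.
move=> eta0; pose z (p : R * R) := w p.1 p.2 - eta * (p.1 - a).
have zcont : {within `[a, b]%classic `*` `[0, L]%classic, continuous z}.
  move=> p; apply: cvgB; first exact: wcont.
  apply: cvgM; first exact: cvg_cst.
  apply: cvgB; last exact: cvg_cst.
  by apply: (@continuous_subspaceT _ _ _ (fst : R * R -> R)) => q; exact: cvg_fst.
have [||//|[t0 x0]] := @compact_EVT_max _ _ z (`[a, b]%classic `*` `[0, L]%classic).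
- by exists (t, x); split; rewrite /= in_itv.
- by apply: compact_setX; exact: segment_compact.
rewrite inE => -[/= t0ab x0L] zmax.
apply: (@le_trans _ _ (z (t0, x0))).
  by have := zmax (t, x); apply; rewrite inE; split; rewrite /= in_itv.
rewrite /z/=; move: t0ab x0L; rewrite !in_itv/= => t0ab x0L.
have zle s : a <= s -> eta * (s - a) >= 0 by move=> ?; apply: mulr_ge0; lra.
have [t0a|t0a] := eqVneq t0 a.
  by rewrite t0a subrr mulr0 subr0; exact: wini.
have [x00|x00] := eqVneq x0 0.
  have [+ _] := wlat _ t0ab; rewrite x00; have := zle t0; move: t0ab => /andP[-> _] /(_ isT); lra.
have [x0L'|x0L'] := eqVneq x0 L.
  have [_] := wlat _ t0ab; rewrite x0L'; have := zle t0; move: t0ab => /andP[-> _] /(_ isT); lra.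
exfalso.
have /andP[at0 t0b] : a < t0 <= b by move: t0ab => /andP[at0 ->]; rewrite lt_neqAle eq_sym t0a at0.
have /andP[x0_gt0 x0_ltL] : 0 < x0 < L.
  by move: x0L => /andP[x0_ge0 x0_leL]; rewrite !lt_neqAle x0L' x0_leL eq_sym x00 x0_ge0.
have [|| dt dx dxx wE] := wheat t0 x0; [by rewrite at0|by rewrite x0_gt0|].
have : 0 <= wt t0 x0 - eta * (1 - 0).
  apply: (@left_max_derive_ge0 _ (fun s => w s x0 - eta * (s - a)) a t0) => //.
  move=> s /andP[as_ st0]; apply: (zmax (s, x0)); rewrite inE; split => /=; rewrite in_itv/=.
    by rewrite as_/=; lra.
  by rewrite !ltW.
have : wxx t0 x0 <= 0.
  apply: (@max_second_derivative_le0 _ (w t0) (wx t0) 0 L x0) => //.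
  - by rewrite x0_gt0.
  - by move=> y y0L; have [||] := wheat t0 y => //; rewrite at0.
  move=> y /andP[y0 yL]; have := zmax (t0, y); rewrite inE /z/= => H.
  have : w t0 y - eta * (t0 - a) <= w t0 x0 - eta * (t0 - a).
    by apply: H; split; rewrite /= in_itv/= ?t0ab// !ltW.
  lra.
rewrite wE; lra.
Qed.

(** * Density of sine sums *)

Lemma segment_unif_continuous (R : realType) (f : R -> R) (a b e : R) :
  {within `[a, b]%classic, continuous f} -> 0 < e ->
  exists2 d : R, 0 < d & forall x y, a <= x <= b -> a <= y <= b ->
    `|x - y| < d -> `|f x - f y| < e.
Proof.
move=> /subspace_continuousP fc e0.
have /compact_near_coveringP cov := @segment_compact R a b.
pose P (d x : R) := forall y, a <= y <= b -> `|x - y| < d ->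
  a <= x <= b -> `|f x - f y| < e.
have e20 : 0 < e / 2 by rewrite divr_gt0.
have : \forall d \near 0^'+, forall x, `[a, b]%classic x -> P d x.
  apply: (cov R 0^'+ P) => x0 x0ab.
  have /cvgrPdist_lt/(_ _ e20) := fc _ x0ab.
  rewrite near_withinE => -[r /= r0 H].
  exists (ball x0 (r / 2), [set d | 0 < d < r / 2]).
    split; first by apply: nbhsx_ballx; rewrite divr_gt0.
    by exists (r / 2); rewrite /= ?divr_gt0// => d /=; rewrite sub0r normrN => + d0;
      rewrite gtr0_norm// d0.
  move=> [x d] /= [x0x /andP[d0 dr]] y yab xyd xab.
  have fx : `|f x0 - f x| < e / 2.
    by apply: H; rewrite /= ?in_itv//; apply: lt_trans x0x _; lra.
  have fy : `|f x0 - f y| < e / 2.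
    apply: H; rewrite /= ?in_itv//.
    rewrite (_ : x0 - y = (x0 - x) + (x - y)); last by ring.
    apply: le_lt_trans (ler_normD _ _) _; move: x0x; rewrite /ball/= => x0x; lra.
  rewrite (_ : f x - f y = (f x0 - f y) - (f x0 - f x)); last by ring.
  apply: le_lt_trans (ler_normB _ _) _; lra.
move=> [d /= d0 H]; exists (d / 2); first by rewrite divr_gt0.
move=> x y xab yab xy; apply: (H (d / 2)) => //=; rewrite ?in_itv//= ?divr_gt0//.
by rewrite sub0r normrN gtr0_norm ?divr_gt0//; lra.
Qed.

(* [bernstein n phi] is the Bernstein polynomial of degree [n] taking the
   value [phi k] at the [k]-th node; this recursion avoids binomials. *)
Fixpoint bernstein (R : realType) (n : nat) (phi : nat -> R) : {poly R} :=
  if n is m.+1 then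
    (1 - 'X) * bernstein m phi + 'X * bernstein m (fun k => phi k.+1)
  else (phi 0%N)%:P.

(** This is the second moment about [c] of the binomial law: squared bias plus variance
    [n y (1 - y)]. The family is stable under the shift of the recursion, which turns [c] into
    [c - 1]. *)
Lemma bernstein_moment2 (R : realType) (n : nat) (e K c y : R) :
  (bernstein n (fun k => e + K * (k%:R - c) ^+ 2)).[y] =
  e + K * ((n%:R * y - c) ^+ 2 + n%:R * y * (1 - y)).
Proof.
elim: n c => [|n IH] c /=; first by rewrite hornerC; ring.
rewrite !hornerE /= IH.
have -> : (fun k => e + K * (k.+1%:R - c) ^+ 2) =
          (fun k => e + K * (k%:R - (c - 1)) ^+ 2).
  by apply/funext => k; rewrite -[k.+1]addn1 natrD; ring.
by rewrite IH -[n.+1]addn1 natrD; ring.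
Qed.

(** Each step of the recursion is a convex combination, so the Bernstein operator is positive and
    fixes constants. *)
Lemma bernstein_le (R : realType) (n : nat) (phi chi : nat -> R) (v y : R) :
  0 <= y <= 1 -> (forall k, (k <= n)%N -> `|phi k - v| <= chi k) ->
  `|(bernstein n phi).[y] - v| <= (bernstein n chi).[y].
Proof.
move=> /andP[y0 y1]; elim: n phi chi => [|n IH] phi chi H /=.
  by rewrite !hornerC; exact: H.
rewrite !hornerE /=.
have h1 : `|(bernstein n phi).[y] - v| <= (bernstein n chi).[y].
  by apply: IH => k kn; apply: H; exact: leq_trans kn _.
have h2 : `|(bernstein n (fun k => phi k.+1)).[y] - v|
          <= (bernstein n (fun k => chi k.+1)).[y].
  by apply: (IH (fun k => phi k.+1) (fun k => chi k.+1)) => k kn; exact: H.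
set p := (bernstein n phi).[y] in h1 *.
set q := (bernstein n (fun k => phi k.+1)).[y] in h2 *.
rewrite (_ : _ - v = (1 - y) * (p - v) + y * (q - v)); last by ring.
apply: le_trans (ler_normD _ _) _; rewrite !normrM.
rewrite (ger0_norm y0) (ger0_norm (_ : 0 <= 1 - y)) ?subr_ge0//.
by rewrite lerD// ler_wpM2l ?subr_ge0.
Qed.

(** * Trigonometric identities and inequalities *)

Lemma sin_prod_sumE (R : realType) (x y : R) :
  sin x * cos y = (sin (x + y) + sin (x - y)) / 2.
Proof. by rewrite sinD sinB; field. Qed.

Lemma sin_sub_prodE (R : realType) (x y : R) :
  sin x - sin y = 2 * cos ((x + y) / 2) * sin ((x - y) / 2).
Proof.
pose p := (x + y) / 2; pose q := (x - y) / 2.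
rewrite -/p -/q (_ : x = p + q) 1?(_ : y = p - q) /p/q; try by field.
by rewrite sinD sinB; ring.
Qed.

Lemma cos_sub_prodE (R : realType) (x y : R) :
  cos x - cos y = 2 * sin ((x + y) / 2) * sin ((y - x) / 2).
Proof.
pose p := (x + y) / 2; pose q := (y - x) / 2.
rewrite -/p -/q (_ : x = p - q) 1?(_ : y = p + q) /p/q; try by field.
by rewrite cosB cosD; ring.
Qed.

Lemma sin_le_middle (R : realType) (x y : R) :
  0 <= x -> x <= y <= pi - x -> sin x <= sin y.
Proof.
move=> x0 /andP[xy ypix]; rewrite -subr_ge0 sin_sub_prodE.
have pi0 := pi_gt0 R.
apply: mulr_ge0; first apply: mulr_ge0 => //.
  by apply: cos_ge0_pihalf; apply/andP; split; lra.
by apply: sin_ge0_pi; apply/andP; split; lra.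
Qed.

(** Cosine is flattest at the ends of [[0, pi]]: for a given distance, the difference of cosines is
    smallest when one of the points is an end. The excess over this case factors into nonnegative
    sines and cosines. *)
Lemma cos_sub_ge (R : realType) (x y d : R) :
  0 <= x <= pi -> 0 <= y <= pi -> 0 <= d <= `|x - y| ->
  1 - cos d <= `|cos x - cos y|.
Proof.
have pi0 := pi_gt0 R.
wlog xy : x y / x <= y => [H xpi ypi dxy|].
  have [xy|/ltW yx] := leP x y; first exact: H.
  by rewrite distrC; apply: H => //; rewrite distrC.
move=> /andP[x0 xpi] /andP[y0 ypi]; rewrite ler0_norm ?subr_le0// => /andP[d0 dxy].
apply: le_trans (ler_norm _).
have : cos (y - x) <= cos d.
  have [->|/eqP dn] := eqVneq d (y - x); first by [].
  apply: ltW; rewrite ltr_cos ?in_itv/=; try (apply/andP; split; lra).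
  by rewrite lt_neqAle; apply/andP; split; [exact/eqP|lra].
suff : 0 <= cos x - cos y - (1 - cos (y - x)) by lra.
have -> : 1 - cos (y - x) = cos 0 - cos (y - x) by rewrite cos0.
rewrite !cos_sub_prodE !subr0 add0r -mulrBl -mulrBr sin_sub_prodE.
apply: mulr_ge0; last by apply: sin_ge0_pi; apply/andP; split; lra.
rewrite !mulr_ge0//.
  by apply: cos_ge0_pihalf; apply/andP; split; lra.
by apply: sin_ge0_pi; apply/andP; split; lra.
Qed.

Definition sine_sum (R : realType) (L : R) (K : nat) (a : nat -> R) (x : R) : R :=
  \sum_(k < K) a k * sin (k.+1%:R * (pi * x / L)).

Definition is_sine_sum (R : realType) (f : R -> R) : Prop :=
  exists K (a : nat -> R), forall th, f th = \sum_(k < K) a k * sin (k.+1%:R * th).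

Lemma is_sine_sumD (R : realType) (f g : R -> R) :
  is_sine_sum f -> is_sine_sum g -> is_sine_sum (fun th => f th + g th).
Proof.
move=> [K [a fE]] [K' [b gE]].
exists (K + K')%N, (fun k => (if (k < K)%N then a k else 0) + (if (k < K')%N then b k else 0)).
move=> th; under eq_bigr do rewrite mulrDl; rewrite big_split/=; congr +%R.
  rewrite fE (big_ord_widen (K + K') (fun k => a k * sin (k.+1%:R * th))) ?leq_addr//.
  by rewrite big_mkcond; apply: eq_bigr => k _; case: ifP => //; rewrite mul0r.
rewrite gE (big_ord_widen (K + K') (fun k => b k * sin (k.+1%:R * th))) ?leq_addl//.
by rewrite big_mkcond; apply: eq_bigr => k _; case: ifP => //; rewrite mul0r.
Qed.

Lemma is_sine_sum_sin (R : realType) (c : R) m :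
  is_sine_sum (fun th : R => c * sin (m%:R * th)).
Proof.
case: m => [|m].
  by exists 0%N, (fun=> 0) => th; rewrite big_ord0 mul0r sin0 mulr0.
exists m.+1, (fun k => if k == m then c else 0) => th.
rewrite big_ord_recr/= eqxx big1 ?add0r// => k _.
by rewrite ltn_eqF// mul0r.
Qed.

Lemma is_sine_sum_sum (R : realType) (F : nat -> R -> R) K :
  (forall k, (k < K)%N -> is_sine_sum (F k)) ->
  is_sine_sum (fun th : R => \sum_(k < K) F k th).
Proof.
elim: K => [|K IH] H.
  by exists 0%N, (fun=> 0) => th; rewrite !big_ord0.
under eq_fun do rewrite big_ord_recr/=.
by apply: is_sine_sumD; [apply: IH => k kK; apply: H; exact: ltnW|exact: H].
Qed.

(** Multiplication by [cos th] sends [sin (k.+1 th)] to the half sum of [sin (k.+2 th)] and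
    [sin (k th)], so every step of the Horner scheme stays among sine sums. *)
Lemma is_sine_sum_sin_horner (R : realType) (p : {poly R}) :
  is_sine_sum (fun th : R => sin th * p.[cos th]).
Proof.
elim/poly_ind: p => [|p c [K [a IH]]].
  by exists 0%N, (fun=> 0) => th; rewrite big_ord0 horner0 mulr0.
have -> : (fun th => sin th * (p * 'X + c%:P).[cos th]) =
  (fun th => (\sum_(k < K) (a k / 2 * sin (k.+2%:R * th) + a k / 2 * sin (k%:R * th)))
             + c * sin (1%:R * th)).
  apply/funext => th; rewrite !hornerE mulrDr mulrA IH [c * _]mulrC; congr +%R.
  rewrite mulr_suml; apply: eq_bigr => k _.
  rewrite -mulrA sin_prod_sumE -mulrDr -mulrA [_^-1 * _]mulrC; congr (_ * ((sin _ + sin _) / _)).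
    by rewrite -[k.+2]addn1 (natrD _ k.+1) mulrDl mul1r.
  by rewrite -[k.+1]addn1 (natrD _ k) mulrDl mul1r addrK.
apply: is_sine_sumD; last exact: is_sine_sum_sin.
apply: (@is_sine_sum_sum _ (fun k th =>
  a k / 2 * sin (k.+2%:R * th) + a k / 2 * sin (k%:R * th))) => k _.
by apply: is_sine_sumD; exact: is_sine_sum_sin.
Qed.

(** Away from the ends, [g / sin] is a continuous function of the cosine; a Bernstein polynomial in
    [y = (1 + cos) / 2] approximates it, and multiplying back by the sine gives a sine sum. One [e]
    pays for the behaviour at the ends, two for the Bernstein approximation. *)
Lemma sine_sum_dense_aux (R : realType) (L e : R) (g : R -> R) :
  0 < L -> 0 < e -> {within `[0, L]%classic, continuous g} -> g 0 = 0 -> g L = 0 ->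
  exists K (a : nat -> R), forall x, 0 <= x <= L -> `|g x - sine_sum L K a x| <= 3 * e.
Proof.
move=> L0 e0 gc g0 gL.
have pi0 := pi_gt0 R.
pose th (x : R) := pi * x / L.
have thE (x : R) : 0 <= x <= L -> 0 <= th x <= pi.
  move=> /andP[x0 xL]; apply/andP; split.
    by rewrite divr_ge0 ?mulr_ge0// ltW.
  by rewrite /th ler_pdivrMr// ler_pM2l.
have [d0 d00 Hd0] := segment_unif_continuous gc e0.
pose d := Num.min (d0 / 2) (L / 2).
have d_gt0 : 0 < d by rewrite lt_min !divr_gt0.
have dd0 : d < d0 by rewrite gt_min; apply/orP; left; lra.
have dL : d <= L / 2 by rewrite ge_min lexx orbT.
pose s := sin (th d).
have thd : 0 < th d by rewrite divr_gt0 ?mulr_gt0.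
have thd2 : th d <= pi / 2.
  by rewrite /th ler_pdivrMr// -mulrA ler_pM2l// mulrC.
have s0 : 0 < s by apply: sin_gt0_pi; rewrite thd/=; lra.
have gs x : 0 <= x <= L -> sin (th x) < s -> `|g x| <= e.
  move=> /andP[x0 xL] xs.
  have [xd|dx] := ltP x d.
    have := Hd0 x 0; rewrite g0 !subr0 ger0_norm// => H.
    by apply/ltW/H; rewrite ?x0 ?lexx ?ltW//; lra.
  have [xd|dx'] := ltP (L - d) x.
    have := Hd0 x L; rewrite gL subr0 ler0_norm ?subr_le0// => H.
    by apply/ltW/H; rewrite ?x0 ?lexx ?xL ?andbT//= ?ltW//; lra.
  move: xs; rewrite ltNge sin_le_middle//; first exact: ltW.
  apply/andP; split; first by rewrite /th ler_pM2r ?invr_gt0// ler_pM2l.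
  have -> : pi - th d = th (L - d) by rewrite /th; field; rewrite gt_eqF.
  by rewrite /th ler_pM2r ?invr_gt0// ler_pM2l.
(* [g / sin] may be unbounded near the ends. Truncating the denominator from below at [s] repairs
   this; the error is at most [|g|] where the sine is below [s], and [g] is small there. *)
pose H x := g x / Num.max (sin (th x)) s.
have ms x : 0 < Num.max (sin (th x)) s by rewrite lt_max s0 orbT.
have thc : continuous th.
  by move=> x; apply: cvgM; [apply: cvgM; [exact: cvg_cst|exact: cvg_id]|exact: cvg_cst].
have Hc : {within `[0, L]%classic, continuous H}.
  move=> x; apply: cvgM; first exact: gc.
  apply: cvgV; first by rewrite gt_eqF.
  apply: (@continuous_subspaceT _ _ _ (fun x => Num.max (sin (th x)) s)) => y.
  apply: (@continuous_max R R (fun x => sin (th x)) (cst s)); last exact: cvg_cst.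
  by apply: continuous_comp; [exact: thc|exact: continuous_sin].
have gH x : 0 <= x <= L -> `|g x - sin (th x) * H x| <= e.
  move=> xL; have sin0 : 0 <= sin (th x) by apply/sin_ge0_pi/thE.
  have [xs|sx] := ltP (sin (th x)) s.
    rewrite /H; have -> : Num.max (sin (th x)) s = s by apply/max_idPr/ltW.
    rewrite (_ : _ - _ = g x * (1 - sin (th x) / s)); last by ring.
    rewrite normrM (ger0_norm (_ : 0 <= 1 - _)); last first.
      by rewrite subr_ge0 ler_pdivrMr// mul1r ltW.
    apply: le_trans (gs _ xL xs); rewrite ler_piMr//.
    by rewrite gerBl divr_ge0// ltW.
  rewrite /H; have -> : Num.max (sin (th x)) s = sin (th x) by apply/max_idPl.
  rewrite mulrC divfK ?subrr ?normr0 ?(ltW e0)//.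
  by rewrite gt_eqF// (lt_le_trans s0).
have [r r0 Hr] := segment_unif_continuous Hc e0.
have [xM _ HM] := @EVT_max _ (fun x => `|H x|) 0 L (ltW L0) (fun x => cvg_norm (Hc x)).
pose M := `|H xM|; have M0 : 0 <= M by exact: normr_ge0.
pose y x := (1 + cos (th x)) / 2.
(* A lower bound for the variation of [y] between points at least [r] apart; the minimum with [L]
   keeps the angle in [[0, pi]]. *)
pose D := (1 - cos (th (Num.min r L))) / 2.
have D0 : 0 < D.
  have rL : 0 < Num.min r L by rewrite lt_min r0.
  have t0 : 0 < th (Num.min r L) by rewrite divr_gt0 ?mulr_gt0.
  rewrite divr_gt0// subr_gt0 -[ltRHS](cos0 R) ltr_cos// in_itv/= ?lexx ?(ltW pi0)//.
  by apply: thE; rewrite ltW//= ge_min lexx orbT.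
(* Close points use uniform continuity, distant ones the quadratic term, which then exceeds [2 * M].
   A bound of this quadratic form is exactly what the second moment evaluates. *)
have key x x' : 0 <= x <= L -> 0 <= x' <= L ->
    `|H x - H x'| <= e + 2 * M / D ^+ 2 * (y x - y x') ^+ 2.
  move=> xL x'L; have [xx|xx] := ltP `|x - x'| r.
    apply: ltW; apply: (lt_le_trans (Hr _ _ xL x'L xx)).
    by rewrite lerDl mulr_ge0 ?sqr_ge0// divr_ge0 ?sqr_ge0// mulr_ge0.
  have : D <= `|y x - y x'|.
    have -> : y x - y x' = (cos (th x) - cos (th x')) / 2 by rewrite /y; field.
    rewrite /D normrM [X in _ <= _ * X]gtr0_norm// ler_pM2r//.
    apply: cos_sub_ge; try exact: thE.
    rewrite divr_ge0 ?mulr_ge0 ?le_min ?(ltW r0) ?(ltW pi0) ?(ltW L0)//=.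
    rewrite /th -mulrBl -mulrBr !normrM (gtr0_norm pi0).
    rewrite [X in _ <= _ * X]gtr0_norm ?invr_gt0//.
    by rewrite ler_pM2r ?invr_gt0// ler_pM2l// ge_min xx.
  move=> Dy; have : D ^+ 2 <= (y x - y x') ^+ 2.
    by rewrite -[leRHS](real_normK (num_real _)) ler_sqr// nnegrE ltW.
  move=> H1.
  have : `|H x - H x'| <= 2 * M.
    apply: le_trans (ler_normB _ _) _.
    by rewrite mulr_natl mulr2n lerD// HM// in_itv.
  move=> H2; apply: le_trans H2 _.
  apply: (@le_trans _ _ (0 + 2 * M * 1)); first by rewrite add0r mulr1.
  rewrite lerD ?(ltW e0)// -[leRHS]mulrA ler_wpM2l ?mulr_ge0//.
  by rewrite mulrC ler_pdivlMr ?exprn_gt0// mul1r.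
have [n n0 Hn] : exists2 n, (0 < n)%N & 2 * M / D ^+ 2 / n%:R <= e.
  pose n := (Num.truncn (2 * M / D ^+ 2 / e)).+1; exists n => //.
  by rewrite ler_pdivrMr// [e * _]mulrC -ler_pdivrMr//; exact/ltW/truncnS_gt.
pose node k := L / pi * acos (2 * (k%:R / n%:R) - 1).
have n_gt0 : 0 < n%:R :> R by rewrite ltr0n.
have nodeP k : (k <= n)%N -> 0 <= node k <= L /\ y (node k) = k%:R / n%:R.
  move=> kn; rewrite /node; set q := k%:R / n%:R.
  have /andP[q0 q1] : 0 <= q <= 1.
    by rewrite divr_ge0//= ler_pdivrMr// mul1r ler_nat.
  have kn2 : -1 <= 2 * q - 1 <= 1 by apply/andP; split; lra.
  split.
    apply/andP; split; first by rewrite mulr_ge0 ?acos_ge0// divr_ge0// ltW.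
    by rewrite mulrAC ler_pdivrMr// ler_pM2l// acos_lepi.
  rewrite /y /th (_ : pi * _ / L = acos (2 * q - 1)); last first.
    by move: (pi : R) pi0 => p p0; field; rewrite !gt_eqF.
  by rewrite acosK ?in_itv//=; field.
pose Q := bernstein n (H \o node).
have HQ x : 0 <= x <= L -> `|H x - Q.[y x]| <= e + e.
  move=> xL; rewrite distrC.
  have y01 : 0 <= y x <= 1.
    have := cos_geN1 (th x); have := cos_le1 (th x); rewrite /y => *.
    by apply/andP; split; lra.
  pose chi k := e + 2 * M / D ^+ 2 / n%:R ^+ 2 * (k%:R - n%:R * y x) ^+ 2.
  apply: (@le_trans _ _ (bernstein n chi).[y x]).
    apply: bernstein_le => // k kn /=; have [nkL ynk] := nodeP k kn.
    apply: le_trans (key _ _ nkL xL) _; rewrite ynk /chi lerD2l.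
    rewrite le_eqVlt; apply/orP; left; apply/eqP; field.
    by rewrite !gt_eqF.
  rewrite bernstein_moment2 lerD2l subrr expr0n/= add0r.
  apply: le_trans Hn; rewrite [leLHS](_ : _ = 2 * M / D ^+ 2 / n%:R * (y x * (1 - y x))); last first.
    by field; rewrite !gt_eqF.
  have /andP[y0 y1] := y01.
  rewrite ler_piMr ?divr_ge0 ?mulr_ge0 ?sqr_ge0//.
  by rewrite mulr_ile1 ?subr_ge0// gerBl.
have [K [a aE]] := is_sine_sum_sin_horner (Q \Po (2^-1 *: (1 + 'X))).
exists K, a => x xL.
have -> : sine_sum L K a x = sin (th x) * Q.[y x].
  rewrite /sine_sum -aE horner_comp !hornerE; congr (_ * Q.[_]).
  by rewrite /y mulrC.
rewrite (_ : _ - _ = (g x - sin (th x) * H x) + sin (th x) * (H x - Q.[y x])); last by ring.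
apply: le_trans (ler_normD _ _) _; rewrite normrM.
rewrite (_ : 3 * e = e + 1 * (e + e)); last by ring.
by rewrite lerD ?gH// ler_pM// ?sin_max// HQ.
Qed.

Lemma sine_sum_dense (R : realType) (L e : R) (g : R -> R) :
  0 < L -> 0 < e -> {within `[0, L]%classic, continuous g} -> g 0 = 0 -> g L = 0 ->
  exists K (a : nat -> R), forall x, 0 <= x <= L -> `|g x - sine_sum L K a x| <= e.
Proof.
move=> L0 e0 gc g0 gL.
have e30 : 0 < e / 3 by rewrite divr_gt0.
have [K [a H]] := sine_sum_dense_aux L0 e30 gc g0 gL.
by exists K, a => x /H; rewrite mulrC divfK.
Qed.

(** * Sine polynomials and interpolation *)

(** Multiplied by [2 sin h], with [h] half the step of the angles, the sum telescopes. It is [1]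
    rather than [0] for odd [m] because [j = 0] is included and [j = M] is not. *)
Lemma sum_cos_arith (R : realType) (M m : nat) :
  (0 < m < 2 * M)%N ->
  \sum_(j < M) cos (m%:R * (j%:R * (pi / M%:R))) = (1 - (-1) ^+ m) / 2 :> R.
Proof.
move=> /andP[m0 mM].
have pi0 := pi_gt0 R.
have M0 : (0 < M)%N by rewrite -(@ltn_pmul2l 2)// muln0 (leq_ltn_trans _ mM).
have M0R : 0 < M%:R :> R by rewrite ltr0n.
pose h : R := m%:R * (pi / M%:R) / 2.
have h_gt0 : 0 < h by rewrite divr_gt0// mulr_gt0 ?ltr0n// divr_gt0.
have h_ltpi : h < pi.
  rewrite /h [pi / _]mulrC mulrA mulrAC gtr_pMl// -mulrA -invfM mulrC.
  by rewrite ltr_pdivrMl ?mulr1 ?mulr_gt0// -natrM ltr_nat mulnC.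
have sinh : 0 < sin h by apply: sin_gt0_pi; rewrite h_gt0.
have E n : 2 * sin h * \sum_(j < n) cos (m%:R * (j%:R * (pi / M%:R))) =
    sin (2 * n%:R * h - h) + sin h.
  elim: n => [|n IH]; first by rewrite big_ord0 !mulr0 mul0r sub0r sinN addNr.
  rewrite big_ord_recr/= mulrDr {}IH.
  have -> : m%:R * (n%:R * (pi / M%:R)) = 2 * n%:R * h by rewrite /h; field; rewrite gt_eqF.
  have -> : 2 * n.+1%:R * h - h = 2 * n%:R * h + h.
    by rewrite -[n.+1]addn1 natrD; ring.
  rewrite sinB sinD; ring.
have := E M.
have -> : 2 * M%:R * h - h = - h + pi *+ m.
  rewrite /h -mulr_natl; move: (pi : R) => p; field; rewrite gt_eqF//.
rewrite (alternatingn (@sinDpi R)) sinN => EM.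
apply: (@mulfI _ (2 * sin h)); first by rewrite mulf_neq0// gt_eqF.
by rewrite EM /=; field.
Qed.

(** Product to sum: [l - k] and [k + l] have the same parity, so the parity terms of [sum_cos_arith]
    cancel when [k] and [l] differ. *)
Lemma sine_orthogonality (R : realType) (M k l : nat) :
  (0 < k < M)%N -> (0 < l < M)%N ->
  \sum_(j < M) sin (k%:R * (j%:R * (pi / M%:R))) * sin (l%:R * (j%:R * (pi / M%:R)))
  = (k == l)%:R * M%:R / 2 :> R.
Proof.
wlog kl : k l / (k <= l)%N => [H kM lM|].
  have [kl|/ltnW lk] := leqP k l; first exact: H.
  by under eq_bigr do rewrite mulrC; rewrite eq_sym; exact: H.
move=> /andP[k0 kM] /andP[l0 lM].
pose h : R := pi / M%:R.
have E (j : 'I_M) : true -> sin (k%:R * (j%:R * h)) * sin (l%:R * (j%:R * h)) =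
    2^-1 * cos ((l - k)%:R * (j%:R * h)) - 2^-1 * cos ((k + l)%:R * (j%:R * h)).
  by move=> _; rewrite natrD natrB// mulrBl mulrDl cosB cosD; field.
rewrite (eq_bigr _ E) big_split/= sumrN -!mulr_sumr.
rewrite [X in _ - _ * X]sum_cos_arith; last first.
  by rewrite addn_gt0 k0/= mul2n -addnn -addSn leq_add// ltnW.
have [<-|kl'] := eqVneq k l.
  rewrite subnn; under eq_bigr do rewrite mul0r cos0.
  rewrite sumr_const card_ord addnn -mul2n exprM sqrrN expr1n expr1n mul1r.
  by field.
rewrite sum_cos_arith.
  rewrite !mul0r -signr_odd oddB// -[in X in _ - X]signr_odd oddD [odd l (+) _]addbC.
  by rewrite subrr.
rewrite subn_gt0 ltn_neqAle kl' kl/= (leq_ltn_trans (leq_subr _ _))//.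
by rewrite (leq_trans lM)// leq_pmull.
Qed.

(** Sampling at [N.+1] equispaced points isolates one coefficient exactly, as all frequencies are
    below [N.+1]. *)
Lemma sine_coef_le (R : realType) (N : nat) (a : nat -> R) (S : R) :
  (forall th, 0 <= th <= pi -> `|\sum_(k < N) a k * sin (k.+1%:R * th)| <= S) ->
  forall k, (k < N)%N -> `|a k| <= 2 * S.
Proof.
move=> H k kN; have pi0 := pi_gt0 R.
pose h : R := pi / N.+1%:R.
have N0 : 0 < N.+1%:R :> R by rewrite ltr0n.
have E : a k * (N.+1%:R / 2) = \sum_(j < N.+1)
    (\sum_(i < N) a i * sin (i.+1%:R * (j%:R * h))) * sin (k.+1%:R * (j%:R * h)).
  under eq_bigr do rewrite mulr_suml.
  rewrite exchange_big/= (bigD1 (Ordinal kN))//= [X in _ + X]big1 ?addr0.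
    under eq_bigr do rewrite -mulrA.
    by rewrite -mulr_sumr sine_orthogonality ?ltnS ?kN// eqxx mul1r.
  move=> i ik; under eq_bigr do rewrite -mulrA.
  rewrite -mulr_sumr sine_orthogonality ?ltnS ?kN ?ltn_ord// eqSS.
  by rewrite (negbTE (_ : (i : nat) != k)) ?mul0r ?mulr0//; exact: ik.
rewrite -(ler_pM2r (_ : 0 < N.+1%:R / 2)) ?divr_gt0//.
rewrite -[X in `|_| * X]ger0_norm ?divr_ge0// -normrM E.
apply: le_trans (ler_norm_sum _ _ _) _.
apply: (@le_trans _ _ (\sum_(j < N.+1) S)); last first.
  by rewrite sumr_const card_ord -mulr_natr le_eqVlt; apply/orP; left; apply/eqP; field.
apply: ler_sum => j _; rewrite normrM -[leRHS]mulr1 ler_pM ?sin_max//.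
apply: H; apply/andP; split.
  by rewrite mulr_ge0// divr_ge0// ltW.
by rewrite /h mulrA ler_pdivrMr// mulrC ler_pM2l// ler_nat ltnW.
Qed.

(** These are the Chebyshev polynomials of the second kind; the three-term recurrence requires two
    consecutive ones in the induction. *)
Lemma sin_multiple_horner (R : realType) (k : nat) :
  exists2 p : {poly R}, (size p <= k.+1)%N &
    forall th, sin (k.+1%:R * th) = sin th * p.[cos th].
Proof.
suff : (exists2 p : {poly R}, (size p <= k.+1)%N &
    forall th, sin (k.+1%:R * th) = sin th * p.[cos th]) /\
  (exists2 p : {poly R}, (size p <= k.+2)%N &
    forall th, sin (k.+2%:R * th) = sin th * p.[cos th]) by case.
elim: k => [|k [[p sp pE] [q sq qE]]].
  split; first by exists 1; rewrite ?size_poly1// => th; rewrite hornerC mulr1 mul1r.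
  exists (2%:R *: 'X) => [|th].
    by rewrite (leq_trans (size_scale_leq _ _))// size_polyX.
  by rewrite !hornerE mulr_natl mulr2n sinD /=; ring.
split; first by exists q.
exists (2%:R *: ('X * q) - p) => [|th].
  rewrite (leq_trans (size_polyD _ _))// size_polyN geq_max; apply/andP; split.
    rewrite (leq_trans (size_scale_leq _ _))// (leq_trans (size_polyMleq _ _))//.
    by rewrite size_polyX /= ltnS.
  by rewrite (leq_trans sp)// ltnW.
have -> : sin (k.+3%:R * th) = 2 * (sin (k.+2%:R * th) * cos th) - sin (k.+1%:R * th).
  rewrite sin_prod_sumE -[k.+3]addn1 -[k.+2]addn1 !(natrD _ _ 1) !mulrDl !mul1r addrK.
  by field.
by rewrite qE pE !hornerE /=; ring.
Qed.

Lemma sine_sum_horner (R : realType) (N : nat) (a : nat -> R) :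
  exists2 p : {poly R}, (size p <= N)%N &
    forall th, \sum_(k < N) a k * sin (k.+1%:R * th) = sin th * p.[cos th].
Proof.
elim: N => [|N [p sp pE]].
  by exists 0; rewrite ?size_poly0// => th; rewrite big_ord0 horner0 mulr0.
have [q sq qE] := sin_multiple_horner R N.
exists (p + a N *: q) => [|th].
  rewrite (leq_trans (size_polyD _ _))// geq_max (leq_trans sp)//=.
  exact: leq_trans (size_scale_leq _ _) _.
by rewrite big_ord_recr/= pE qE !hornerE /=; ring.
Qed.

Lemma lagrange_interpolation (F : fieldType) (N : nat) (p : {poly F}) (y : 'I_N -> F) (z : F) :
  (size p <= N)%N -> injective y ->
  p.[z] = \sum_(j < N) p.[y j] * \prod_(i < N | i != j) ((z - y i) / (y j - y i)).
Proof.
move=> sp yinj.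
pose l j : {poly F} := \prod_(i < N | i != j) ((y j - y i)^-1 *: ('X - (y i)%:P)).
have lE j u : (l j).[u] = \prod_(i < N | i != j) ((u - y i) / (y j - y i)).
  by rewrite horner_prod; apply: eq_bigr => i _; rewrite !hornerE mulrC.
have sl j : (size (l j) <= N)%N.
  have N0 : (0 < N)%N by case: (N) j => [[]|].
  rewrite (leq_trans (size_poly_prod_leq _ _))//.
  rewrite (@leq_trans ((\sum_(i < N | i != j) 2).+1 - #|[pred i | i != j]|))//.
    rewrite leq_sub2r// ltnS leq_sum// => i _.
    by rewrite (leq_trans (size_scale_leq _ _))// size_XsubC.
  rewrite sum_nat_const muln2 -addnn subSn ?leq_addr// addnK.
  by rewrite cardC1 card_ord prednK.
have : p - \sum_(j < N) p.[y j] *: l j = 0.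
  apply: (@roots_geq_poly_eq0 _ _ [seq y i | i <- enum 'I_N]).
  - apply/allP => _ /mapP[k _ ->]; rewrite /root !hornerE horner_sum.
    rewrite (bigD1 k)//= [X in _ - (_ + X)]big1 ?addr0.
      rewrite hornerZ lE big1 ?mulr1 ?subrr// => i ik.
      by rewrite divff// subr_eq0; apply: contra ik => /eqP/yinj ->.
    move=> j jk; rewrite hornerZ lE (bigD1 k) 1?eq_sym//= subrr mul0r mul0r mulr0//.
  - by rewrite map_inj_uniq// enum_uniq.
  - rewrite size_map size_enum_ord (leq_trans (size_polyD _ _))// size_polyN.
    rewrite geq_max sp/= (leq_trans (size_sum _ _ _))//.
    by apply/bigmax_leqP => j _; rewrite (leq_trans (size_scale_leq _ _)).
move/eqP; rewrite subr_eq0 => /eqP pE; rewrite {1}pE horner_sum.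
by apply: eq_bigr => j _; rewrite hornerZ lE.
Qed.

(** * Hausdorff content and scattered points *)

Lemma gauge_small (R : realType) (f : R -> R) (e : R) :
  gauge_function f -> 0 < e -> exists2 d, 0 < d & forall t, 0 < t -> t <= d -> f t <= e.
Proof.
move=> gf e0; have /cvgrPdist_lt/(_ _ e0) := gauge_cvg0 gf.
move=> [d /= d0 H]; exists (d / 2); first by rewrite divr_gt0.
move=> t t0 td; have := H t; rewrite /= !sub0r !normrN gtr0_norm//.
have -> : t < d by lra.
by move=> /(_ isT t0) /ltW; apply: le_trans; exact: ler_norm.
Qed.

(** Covers are infinite sequences of nondegenerate balls, so the finite list is completed by balls
    of total cost at most [e]. *)
Lemma hausdorff_content_le_sum (R : realType) (f : R -> R) (E : set R) (s : seq (R * R)) :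
  gauge_function f -> all (fun p => 0 < p.2) s ->
  (forall x, E x -> exists2 p, p \in s & `|p.1 - x| < p.2) ->
  (hausdorff_content f E <= (\sum_(p <- s) f (2 * p.2))%:E)%E.
Proof.
move=> gf s0 sE; apply/lee_addgt0Pr => e e0.
have rhoP n : exists2 rho, 0 < rho & f (2 * rho) <= e / (2 ^ n.+1)%:R.
  have en : 0 < e / (2 ^ n.+1)%:R by rewrite divr_gt0// ltr0n expn_gt0.
  have [d d0 Hd] := gauge_small gf en.
  exists (d / 2); first by rewrite divr_gt0.
  by rewrite mulrC divfK//; exact: Hd.
pose rho n := sval (cid2 (rhoP n)).
have rho0 n : 0 < rho n by rewrite /rho; case: cid2.
have rhof n : f (2 * rho n) <= e / (2 ^ n.+1)%:R by rewrite /rho; case: cid2.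
(* Past the end of [s], the default value of [nth] depends on [n] and supplies the padding balls. *)
pose b n := nth (0, rho n) s n.
have b0 n : 0 < (b n).2.
  rewrite /b; have [ns|sn] := ltnP n (size s); last by rewrite nth_default//=.
  by move/allP: s0; apply; exact: mem_nth.
pose A n : \bar R := if (n < size s)%N then (f (2 * (b n).2))%:E else 0%E.
have f0 (t : R) : 0 < t -> 0 <= f (2 * t) by move=> t0; apply: (gauge_ge0 gf); rewrite mulr_gt0.
have A0 n : (0 <= A n)%E by rewrite /A; case: ifP => // _; rewrite lee_fin f0.
apply: (@le_trans _ _ (\sum_(0 <= j <oo) (f (2 * (b j).2))%:E)%E).
  apply: ereal_inf_lbound; exists (fun n => (b n).1), (fun n => (b n).2); split=> //.
  move=> x /sE [p ps px]; exists (index p s) => //.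
  have -> : b (index p s) = p by rewrite /b nth_index.
  exact: px.
apply: (@le_trans _ _ (\sum_(0 <= j <oo) (A j + (e / (2 ^ j.+1)%:R)%:E))%E).
  apply: lee_nneseries => [n _ _|n _]; first by rewrite lee_fin f0.
  rewrite /A; case: ifPn => [_|]; first by rewrite leeDl// lee_fin divr_ge0// ltW.
  by rewrite -leqNgt add0e => sn; rewrite /b nth_default//= lee_fin.
apply: le_trans (epsilon_trick _ A0 (ltW e0)) _; rewrite leeD2r//.
rewrite (nneseries_split 0 (size s))// add0n [X in (_ + X)%E]eseries0 ?adde0; last first.
  by move=> i si _; rewrite /A ltnNge si.
rewrite (big_nth (0, 0)) -sumEFin big_nat [leRHS]big_nat le_eqVlt; apply/orP; left.
apply/eqP/eq_bigr => i /andP[_ si]; rewrite /A si /b.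
by rewrite (set_nth_default (0, 0)).
Qed.

(* Greedy choice: each new centre consumes at least [p] of the points. *)
Lemma crowded_cover (R : realType) (p : nat) (r : R) (ys : seq R) :
  exists cs : seq R, (size cs * p <= size ys)%N /\
    forall x : R, (p <= count (fun y => (`|x - y| < r)%R) ys)%N -> (0 < p)%N ->
      exists2 c, c \in cs & `|c - x| < 2 * r.
Proof.
have [n] := ubnP (size ys); elim: n ys => // n IH ys; rewrite ltnS => sn.
have [|noex] := pselect (exists2 x : R, (p <= count (fun y => (`|x - y| < r)%R) ys)%N & (0 < p)%N);
  last first.
  by exists [::]; split=> // x px p0; case: noex; exists x.
move=> [x px p0]; pose near_x y := `|x - y| < r.
pose ys' := [seq y <- ys | ~~ near_x y].
have szE : (size ys' + count near_x ys = size ys)%N.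
  by rewrite size_filter addnC count_predC.
have [|cs [scs Hcs]] := IH ys'.
  by rewrite (leq_trans _ sn)// -szE -addn1 leq_add2l (leq_trans p0).
exists (x :: cs); split.
  by rewrite /= mulSn -szE addnC leq_add.
move=> z pz _; have [pz'|] := leqP p (count (fun y => (`|z - y| < r)%R) ys').
  have [c ccs cz] := Hcs z pz' p0.
  by exists c => //; rewrite inE ccs orbT.
move=> pz'; exists x; first by rewrite inE eqxx.
have [/hasP[y yys /andP[xy zy]]|/hasPn H] := boolP (has (fun y => near_x y && (`|z - y| < r)) ys).
  rewrite (_ : x - z = (x - y) - (z - y)); last by ring.
  by apply: le_lt_trans (ler_normB _ _) _; move: xy zy; rewrite /near_x; lra.
exfalso; move: pz'; rewrite ltnNge => /negP; apply; apply: (leq_trans pz).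
rewrite count_filter -!size_filter leq_eqVlt; apply/orP; left.
apply/eqP; congr size; apply: eq_in_filter => y /H /=.
by rewrite negb_and; case: (near_x y) => //=; case: (_ < _).
Qed.

(** The head of the list is the point chosen last: a point need only be uncrowded with respect to
    those chosen before it, which is what a greedy choice provides. *)
Fixpoint scattered (R : realType) (E : set R) (J : nat) (r : nat -> R) (xs : seq R) : Prop :=
  if xs is x :: ys then
    [/\ E x, forall l, (l < J)%N -> (count (fun y => (`|x - y| < 2 * r l)%R) ys < 16 ^ l)%N
      & scattered E J r ys]
  else True.

(* Of the points within [r l] of [z], the first one in the list has all the
   others within [2 * r l]. *)
Lemma scattered_count (R : realType) (E : set R) (J : nat) (r : nat -> R) (xs : seq R) :
  scattered E J r xs -> forall l z, (l < J)%N ->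
  (count (fun y => (`|z - y| < r l)%R) xs <= 16 ^ l)%N.
Proof.
elim: xs => // x ys IH /= [_ Hx /IH{}IH] l z lJ.
have [zx|] := ltP `|z - x| (r l); last by rewrite add0n => _; exact: IH.
rewrite add1n; apply: leq_ltn_trans (Hx l lJ).
apply: sub_count => y /= zy.
rewrite (_ : x - y = (z - y) - (z - x)); last by ring.
by apply: le_lt_trans (ler_normB _ _) _; lra.
Qed.

Lemma scattered_in (R : realType) (E : set R) (J : nat) (r : nat -> R) (xs : seq R) :
  scattered E J r xs -> forall x, x \in xs -> E x.
Proof.
by elim: xs => // x ys IH /= [Ex _ /IH{}IH] y; rewrite inE => /predU1P[->|/IH].
Qed.

(** At level [0], fewer than [16 ^ 0 = 1] neighbours means none. *)
Lemma scattered_uniq (R : realType) (E : set R) (J : nat) (r : nat -> R) (xs : seq R) :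
  (0 < J)%N -> 0 < r 0%N -> scattered E J r xs -> uniq xs.
Proof.
move=> J0 r0; elim: xs => // x ys IH /= [_ /(_ 0%N J0) + /IH ->]; rewrite andbT expn0 ltnS leqn0.
rewrite -leqn0 leqNgt -has_count => /hasPn H; apply/negP => /H.
by rewrite /= subrr normr0 mulr_gt0.
Qed.

Lemma scattered_exists (R : realType) (E : set R) (J N : nat) (r : nat -> R) :
  (forall ys : seq R, (size ys < N)%N -> exists2 x, E x &
     forall l, (l < J)%N -> (count (fun y => (`|x - y| < 2 * r l)%R) ys < 16 ^ l)%N) ->
  exists2 xs, size xs = N & scattered E J r xs.
Proof.
move=> H; suff : forall n, (n <= N)%N -> exists2 xs, size xs = n & scattered E J r xs.
  exact.
elim=> [_|n IH nN]; first by exists [::].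
have [xs sxs xsP] := IH (ltnW nN).
have [|x Ex xP] := H xs; first by rewrite sxs.
by exists (x :: xs); rewrite /= ?sxs.
Qed.

(** The exponent [alpha] enters through [(ln X)^(-alpha) <= (ln X)^(-3/2)]; with [y = J / 2] below,
    this is the origin of the factor [J ^ 3] in the scales. *)
Lemma h_formula_expN_le (R : realType) (alpha X y : R) :
  3 / 2 < alpha -> 0 < X -> 1 <= y -> y <= ln X ->
  h_formula alpha (expR (- X)) <= (Num.sqrt (X * y ^+ 3))^-1.
Proof.
move=> a32 X0 y1 yX; rewrite /h_formula -expRN opprK expRK.
have lX1 : 1 <= ln X by exact: le_trans yX.
have lX0 : 0 < ln X by apply: lt_le_trans lX1.
have y0 : 0 < y by apply: lt_le_trans y1.
rewrite sqrtrM ?(ltW X0)// invfM (powRN X) powR12_sqrt ?(ltW X0)//.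
rewrite ler_wpM2l ?invr_ge0 ?sqrtr_ge0//.
apply: (@le_trans _ _ (ln X `^ (- (3 / 2)))); first by apply: ler_powR => //; lra.
rewrite powRN lef_pV2 ?posrE ?sqrtr_gt0 ?exprn_gt0 ?powR_gt0//.
rewrite powRrM powR12_sqrt ?powR_ge0// ler_sqrt ?powR_ge0//.
by rewrite powR_mulrn ?(ltW lX0)// lerXn2r// nnegrE ltW.
Qed.

Lemma cube_le_exp2 (J : nat) : (10 <= J)%N -> (J ^ 3 <= 2 ^ J)%N.
Proof.
elim: J => // J IH; rewrite leq_eqVlt => /predU1P[<-//|]; rewrite ltnS => J10.
apply: (@leq_trans (2 * J ^ 3)); last by rewrite (expnS 2) leq_mul2l IH.
have -> : (2 * J ^ 3 = J ^ 3 + J * J ^ 2)%N by rewrite mul2n -addnn -expnS.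
have -> : (J.+1 ^ 3 = J ^ 3 + (3 * J ^ 2 + 3 * J + 1))%N by rewrite -addn1; ring.
rewrite leq_add2l (@leq_trans (10 * J ^ 2))// ?leq_mul2r ?J10 ?orbT//.
have : (J <= J ^ 2)%N by rewrite -mulnn leq_pmulr// (leq_trans _ J10).
have : (1 <= J)%N by rewrite (leq_trans _ J10).
move: (J ^ 2)%N => q; lia.
Qed.

(** The logarithmic size [X_l] for which one ball of diameter [exp (- X_l)] costs at most a constant
    times [8^l / 16^J]: [256] and [64] are the squares of [16] and [8], because the gauge behaves
    like [X^(-1/2)], and [J ^ 3] compensates its iterated logarithm. *)
Definition log_scale (R : realType) (B : R) (J l : nat) : R :=
  B * 256 ^+ J / 64 ^+ l / J%:R ^+ 3.

(** The least value, at [l = J], is at least [4^J / J^3], hence at least [2^J], and [2] exceeds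
    [exp (1/2)]. *)
Lemma log_scale_ln (R : realType) (B : R) (J l : nat) :
  1 <= B -> (10 <= J)%N -> (l <= J)%N ->
  0 < log_scale B J l /\ J%:R / 2 <= ln (log_scale B J l).
Proof.
move=> B1 J10 lJ.
have J0 : 0 < J%:R :> R by rewrite ltr0n (leq_trans _ J10).
have B0 : 0 < B by apply: lt_le_trans B1.
have X0 : 0 < log_scale B J l by rewrite !divr_gt0 ?mulr_gt0 ?exprn_gt0.
split=> //; rewrite -ler_expR lnK ?posrE//.
have exp12 : expR 2^-1 <= 2 :> R.
  rewrite -[leLHS]invrK -expRN -[leRHS]invrK lef_pV2 ?posrE ?expR_gt0 ?invr_gt0//.
  by apply: le_trans (expR_ge1Dx _); lra.
rewrite mulrC expRM_natr; apply: (@le_trans _ _ (2 ^+ J)).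
  by rewrite lerXn2r// nnegrE ?expR_ge0.
rewrite /log_scale ler_pdivlMr ?exprn_gt0//.
apply: (@le_trans _ _ (2 ^+ J * 2 ^+ J)).
  by rewrite ler_wpM2l ?exprn_ge0// -!natrX ler_nat cube_le_exp2.
rewrite -exprMn ler_pdivlMr ?exprn_gt0//.
apply: (@le_trans _ _ (1 * 256 ^+ J)); last by rewrite ler_wpM2r ?exprn_ge0.
rewrite mul1r (_ : 256 = 2 * 2 * 64) ?exprMn; last by rewrite -!natrM.
by rewrite ler_wpM2l ?mulr_ge0 ?exprn_ge0// ler_weXn2l// ler1n.
Qed.

Lemma log_scale_ge3 (R : realType) (B : R) (J l : nat) :
  1 <= B -> (10 <= J)%N -> (l <= J)%N -> 3 <= log_scale B J l.
Proof.
move=> B1 J10 lJ; have [X0 lX] := log_scale_ln B1 J10 lJ.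
have := ln_sublinear X0; have : 10%:R <= J%:R :> R by rewrite ler_nat.
lra.
Qed.

Lemma gauge_log_scale_le (R : realType) (alpha b : R) (h : R -> R) (J l : nat) :
  3 / 2 < alpha -> gauge_extension (h_formula alpha) h ->
  1 <= b -> (10 <= J)%N -> (l <= J)%N ->
  h (expR (- log_scale (8 * b ^+ 2) J l)) <= 8 ^+ l / (b * 16 ^+ J).
Proof.
move=> a32 [_ hE _] b1 J10 lJ.
(* The factor [8] cancels the cube of [1 / 2] in [(J / 2) ^ 3], so that a perfect square appears
   under the root. *)
have B1 : 1 <= 8 * b ^+ 2.
  by have : 1 <= b ^+ 2 by [rewrite exprn_ege1]; lra.
have b0 : 0 < b by apply: lt_le_trans b1.
have [X0 lX] := log_scale_ln B1 J10 lJ; have X3 := log_scale_ge3 B1 J10 lJ.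
have J0 : 0 < J%:R :> R by rewrite ltr0n (leq_trans _ J10).
rewrite hE ?expR_gt0//; last by rewrite ler_expR lerN2.
apply: le_trans (h_formula_expN_le a32 X0 _ lX) _.
  by have : 2%:R <= J%:R :> R by [rewrite ler_nat (leq_trans _ J10)]; lra.
have -> : log_scale (8 * b ^+ 2) J l * (J%:R / 2) ^+ 3 = (b * 16 ^+ J / 8 ^+ l) ^+ 2.
  rewrite /log_scale (_ : 256 = 16 * 16); last by rewrite -natrM.
  rewrite (_ : 64 = 8 * 8); last by rewrite -natrM.
  rewrite !exprMn; field; rewrite !expf_neq0// ?gt_eqF//.
rewrite sqrtr_sqr ger0_norm ?invf_div//.
by rewrite divr_ge0 ?mulr_ge0 ?exprn_ge0 ?ltW.
Qed.

(** Crowding is tested within [2 r], the covering balls double this radius, and the diameter is then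
    [8 r = exp (- X_l)]. *)
Definition scale_radius (R : realType) (B : R) (J l : nat) : R :=
  expR (- log_scale B J l) / 8.

(** If the greedy choice stopped too early, [E] would be covered by two balls at the ends of the
    interval and the crowded balls of all levels, at a cost below [c]. The ends are discarded
    because sines vanish there; [delta] and [B] are fixed before [E] and [J]. *)
Lemma content_scattered (R : realType) (L alpha c : R) (h : R -> R) :
  0 < L -> 3 / 2 < alpha -> gauge_extension (h_formula alpha) h -> 0 < c ->
  exists delta B : R, [/\ 0 < delta, delta <= L / 2, 1 <= B &
    forall (J : nat) (E : set R), (10 <= J)%N -> E `<=` `]0, L[ ->
      (c%:E <= hausdorff_content h E)%E ->
      exists2 xs, size xs = (16 ^ J)%N &
        scattered (E `&` `[delta, L - delta]) J (scale_radius B J) xs].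
Proof.
move=> L0 a32 hext c0; have [gh _ _] := hext.
have [d d0 Hd] := @gauge_small _ _ (c / 8) gh ltac:(by rewrite divr_gt0).
pose delta := Num.min (d / 2) (L / 2).
have delta0 : 0 < delta by rewrite lt_min !divr_gt0.
(* The levels will cost at most [2 / b <= c / 4] in total, and each end ball at most [c / 8]; the
   added [1] gives [b >= 1]. *)
pose b := 8 / c + 1; have b1 : 1 <= b by rewrite lerDr divr_ge0// ltW.
have b0 : 0 < b by apply: lt_le_trans b1.
pose B := 8 * b ^+ 2.
have B1 : 1 <= B by rewrite /B; have : 1 <= b ^+ 2 by [rewrite exprn_ege1]; lra.
exists delta, B; split=> //; first by rewrite ge_min lexx orbT.
move=> J E J10 EL cE; apply: scattered_exists => ys sys.
apply: contrapT => nox.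
have /choice [cs csP] : forall l, exists cs : seq R, (size cs * 16 ^ l <= size ys)%N /\
    forall x : R, (16 ^ l <= count (fun y => (`|x - y| < 2 * scale_radius B J l)%R) ys)%N ->
      (0 < 16 ^ l)%N -> exists2 c, c \in cs & `|c - x| < 2 * (2 * scale_radius B J l).
  by move=> l; exact: crowded_cover.
have r0 l : 0 < scale_radius B J l by rewrite divr_gt0// expR_gt0.
pose s := (0, delta) :: (L, delta) ::
  flatten [seq [seq (z, 2 * (2 * scale_radius B J l)) | z <- cs l] | l <- iota 0 J].
have : (c%:E <= (\sum_(p <- s) h (2 * p.2))%:E)%E.
  apply: le_trans cE _; apply: hausdorff_content_le_sum => //.
    rewrite /= delta0/=; apply/allP => _ /flattenP[_ /mapP[l _ ->] /mapP[z _ ->]] /=.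
    by rewrite mulr_gt0// mulr_gt0.
  move=> x Ex; have := EL _ Ex; rewrite /= in_itv/= => /andP[x0 xL].
  have [xd|dx] := ltP x delta.
    by exists (0, delta); rewrite ?inE ?eqxx//= sub0r normrN gtr0_norm.
  have [xd|dx'] := ltP (L - delta) x.
    exists (L, delta); rewrite ?inE ?eqxx ?orbT//= gtr0_norm ?subr_gt0//; lra.
  have [l lJ xl] : exists2 l, (l < J)%N &
      (16 ^ l <= count (fun y => (`|x - y| < 2 * scale_radius B J l)%R) ys)%N.
    apply: contrapT => nol; apply: nox; exists x.
      by split=> //; rewrite /= in_itv/= dx.
    move=> l lJ; rewrite ltnNge; apply/negP => xl; apply: nol; by exists l.
  have [z zcs zx] := (csP l).2 x xl ltac:(by rewrite expn_gt0).
  exists (z, 2 * (2 * scale_radius B J l)) => //.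
  rewrite !inE; apply/orP; right; apply/orP; right; apply/flattenP.
  exists [seq (z, 2 * (2 * scale_radius B J l)) | z <- cs l].
    by apply: map_f; rewrite mem_iota.
  by apply/mapP; exists z.
rewrite lee_fin leNgt => /negP; apply.
rewrite !big_cons big_flatten big_map/=.
have hdelta : h (2 * delta) <= c / 8.
  apply: Hd; first by rewrite mulr_gt0.
  have : delta <= d / 2 by rewrite ge_min lexx.
  lra.
suff : \sum_(l <- iota 0 J) \sum_(p <- [seq (z, 2 * (2 * scale_radius B J l)) | z <- cs l])
    h (2 * p.2) <= c / 4 by lra.
(* Level [l] has at most [16^(J - l)] crowded balls, of cost at most [8^l / (b 16^J)] each. *)
apply: (@le_trans _ _ (\sum_(l <- iota 0 J) b^-1 / 2 ^+ l)).
  rewrite big_seq [leRHS]big_seq; apply: ler_sum => l; rewrite mem_iota add0n/= => lJ.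
  rewrite big_map/= big_const_seq count_predT iter_addr addr0.
  have -> : 2 * (2 * (2 * scale_radius B J l)) = expR (- log_scale B J l).
    by rewrite /scale_radius; field.
  have := gauge_log_scale_le a32 hext b1 J10 (ltnW lJ); rewrite -/B => hle.
  rewrite -[leLHS]mulr_natr; apply: (@le_trans _ _ (8 ^+ l / (b * 16 ^+ J) * (size (cs l))%:R)).
    by rewrite ler_wpM2r.
  have : (size (cs l))%:R * 16 ^+ l <= 16 ^+ J :> R.
    by rewrite -!natrX -natrM ler_nat (leq_trans (csP l).1)// ltnW.
  rewrite -ler_pdivlMr ?exprn_gt0// => scs.
  apply: (@le_trans _ _ (8 ^+ l / (b * 16 ^+ J) * (16 ^+ J / 16 ^+ l))).
    by rewrite ler_wpM2l// divr_ge0 ?mulr_ge0 ?exprn_ge0 ?ltW.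
  rewrite le_eqVlt; apply/orP; left; apply/eqP.
  rewrite (_ : 16 ^+ l = 8 ^+ l * 2 ^+ l); last by rewrite -exprMn -natrM.
  by field; rewrite !expf_neq0 ?gt_eqF.
rewrite -mulr_sumr.
have geo n : \sum_(l <- iota 0 n) (2 ^+ l)^-1 = 2 - 2 / 2 ^+ n :> R.
  elim: n => [|n IH]; first by rewrite big_nil expr0; lra.
  rewrite -[n.+1]addn1 iotaD big_cat/= IH big_seq1 add0n exprD expr1.
  have : (2 ^+ n : R) != 0 by rewrite expf_neq0.
  by move: (2 ^+ n) => q q0; field.
rewrite geo; apply: (@le_trans _ _ (b^-1 * 2)).
  by rewrite ler_wpM2l ?invr_ge0 ?(ltW b0)// gerBl divr_ge0 ?exprn_ge0.
rewrite mulrC ler_pdivrMr// /b mulrDr mulr1.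
by rewrite (_ : c / 4 * (8 / c) = 2); [have := divr_gt0 c0 (_ : 0 < 4); lra|field; rewrite gt_eqF].
Qed.

(** A layer-cake bound for [log (1/d)]: written with indicators of [d < r_(l+1)], it turns the sum
    over all points into counts of points in balls. In the induction, the leading term of level [n]
    becomes the last indicator term of level [n.+1]. *)
Lemma scale_dist_inv_le (R : realType) (B d : R) (J n : nat) :
  1 <= B -> (10 <= J)%N -> (n < J)%N -> 0 < d -> scale_radius B J 0 <= d ->
  d^-1 <= expR (2 * log_scale B J n +
    \sum_(l < n) 2 * log_scale B J l * (d < scale_radius B J l.+1)%R%:R).
Proof.
move=> B1 J10 nJ d0 dr.
(* Since [8 <= exp 3 <= exp X_l], doubling the exponent absorbs the denominator of
   [scale_radius]. *)
have r_ge l : (l < J)%N -> scale_radius B J l <= d -> d^-1 <= expR (2 * log_scale B J l).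
  move=> lJ rd; have X3 := log_scale_ge3 B1 J10 (ltnW lJ).
  rewrite -[leRHS]invrK -expRN lef_pV2 ?posrE ?expR_gt0//; apply: le_trans rd.
  rewrite /scale_radius ler_pdivlMr//.
  apply: (@le_trans _ _ (expR (- (2 * log_scale B J l)) * expR 3)).
    rewrite ler_wpM2l ?expR_ge0// (_ : expR 3 = expR 1 ^+ 3); last first.
      by rewrite -expRM_natl mulr1.
    rewrite (_ : 8 = 2 ^+ 3) ?lerXn2r ?nnegrE ?expR_ge0//; last by rewrite -natrX.
    by have := @expR_ge1Dx R 1; rewrite -natr1.
  by rewrite -expRD ler_expR; lra.
elim: n nJ => [|n IH] nJ; first by rewrite big_ord0 addr0; exact: r_ge.
have Xge l : (l < J)%N -> 0 <= log_scale B J l.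
  by move=> lJ; have := log_scale_ge3 B1 J10 (ltnW lJ); lra.
have [dr'|rd] := ltP d (scale_radius B J n.+1); last first.
  apply: le_trans (r_ge _ nJ rd) _; rewrite ler_expR lerDl sumr_ge0// => l _.
  by rewrite mulr_ge0// mulr_ge0// Xge// (ltn_trans (ltn_ord l)).
apply: le_trans (IH (ltnW nJ)) _.
rewrite ler_expR big_ord_recr/= dr' mulr1 [leLHS]addrC lerDr.
by rewrite mulr_ge0// Xge.
Qed.

(** Level [l] contributes [2 X_l] for at most [16^(l+1)] points; for the last level this is the
    trivial count [N = 16^J]. The sum is a geometric series of ratio [16 / 64]. *)
Lemma scattered_prod_dist (R : realType) (E : set R) (B : R) (J : nat) (xs : seq R)
    (N := (16 ^ J)%N) (j : 'I_N) :
  1 <= B -> (10 <= J)%N -> size xs = N -> scattered E J (scale_radius B J) xs ->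
  \prod_(i < N | i != j) `|nth 0 xs j - nth 0 xs i|^-1 <=
    expR (64 * B * (256 ^+ J / J%:R ^+ 3)).
Proof.
move=> B1 J10 sxs xsP.
have J0 : (0 < J)%N by exact: leq_trans J10.
have r0 l : 0 < scale_radius B J l by rewrite divr_gt0// expR_gt0.
have uxs := scattered_uniq J0 (r0 0%N) xsP.
pose d (i : nat) := `|nth 0 xs j - nth 0 xs i|.
have cnt l : (l < J)%N -> \sum_(i < N) (d i < scale_radius B J l)%R%:R <= (16 ^ l)%:R :> R.
  move=> lJ; have := scattered_count xsP (nth 0 xs j) lJ.
  rewrite -sum1_count big_mkcond (big_nth 0) sxs big_mkord -(ler_nat R) natr_sum.
  by apply: le_trans; rewrite le_eqVlt; apply/orP; left; apply/eqP/eq_bigr => i _; case: ifP.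
have dij (i : 'I_N) : i != j -> 0 < d i /\ scale_radius B J 0 <= d i.
  move=> ij; split.
    by rewrite normr_gt0 subr_eq0 nth_uniq ?sxs// eq_sym.
  (* At most one point lies within [r_0] of the [j]-th one, and that is itself. *)
  rewrite leNgt; apply/negP => di; have := cnt 0%N J0.
  have dj : d j = 0 by rewrite /d subrr normr0.
  rewrite (bigD1 i)//= (bigD1 j) 1?eq_sym//= di dj r0 expn0 /=.
  set S := bigop.body _ _ _; have : 0 <= S by apply: sumr_ge0.
  lra.
have [n nE] : exists n, J = n.+1 by exists J.-1; rewrite prednK.
have nJ : (n < J)%N by rewrite nE.
have X0 l : (l < J)%N -> 0 <= log_scale B J l.
  by move=> lJ; have := log_scale_ge3 B1 J10 (ltnW lJ); lra.
pose t l i := 2 * log_scale B J l * (d i < scale_radius B J l.+1)%R%:R.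
apply: (@le_trans _ _ (\prod_(i < N | i != j) expR (2 * log_scale B J n + \sum_(l < n) t l i))).
  apply: ler_prod => i ij; have [di0 dir] := dij i ij.
  by rewrite invr_ge0 normr_ge0/=; exact: scale_dist_inv_le.
rewrite -expR_sum ler_expR.
have t0 i : 0 <= 2 * log_scale B J n + \sum_(l < n) t l i.
  rewrite addr_ge0//; first by rewrite mulr_ge0// X0.
  by apply: sumr_ge0 => l _; rewrite mulr_ge0// mulr_ge0// X0// (ltn_trans (ltn_ord l)).
apply: (@le_trans _ _ (\sum_(i < N) (2 * log_scale B J n + \sum_(l < n) t l i))).
  by rewrite [leRHS](bigID (fun i => i != j))/= lerDl sumr_ge0.
rewrite big_split/= exchange_big/= sumr_const card_ord -[_ *+ N]mulr_natr.
apply: (@le_trans _ _ (\sum_(l < J) 2 * log_scale B J l * (16 ^ l.+1)%:R)).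
  rewrite nE big_ord_recr/= -nE addrC lerD//.
  apply: ler_sum => l _; rewrite -mulr_sumr ler_wpM2l//.
    by rewrite mulr_ge0// X0// (ltn_trans (ltn_ord l)).
  by apply: cnt; rewrite nE ltnS.
have -> : \sum_(l < J) 2 * log_scale B J l * (16 ^ l.+1)%:R =
    32 * B * (256 ^+ J / J%:R ^+ 3) * \sum_(l < J) (4 ^+ l)^-1.
  rewrite mulr_sumr; apply: eq_bigr => l _; rewrite /log_scale natrX (exprS _ l).
  rewrite (_ : 64 = 16 * 4); last by rewrite -natrM.
  rewrite exprMn; have J0' : J%:R != 0 :> R by rewrite pnatr_eq0 -lt0n.
  have : (16 ^+ l : R) != 0 by rewrite expf_neq0.
  have : (4 ^+ l : R) != 0 by rewrite expf_neq0.
  move: (16 ^+ l : R) (4 ^+ l : R) (256 ^+ J : R) => p q s q0 p0.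
  by field; rewrite ?J0' ?q0 ?p0.
have geo m : \sum_(l < m) (4 ^+ l)^-1 = 4 / 3 - 4 / 3 / 4 ^+ m :> R.
  elim: m => [|m IH]; first by rewrite big_ord0 expr0; lra.
  rewrite big_ord_recr/= IH exprS; have : (4 ^+ m : R) != 0 by rewrite expf_neq0.
  by move: (4 ^+ m) => q q0; field.
have g2 : \sum_(l < J) (4 ^+ l)^-1 <= 2 :> R.
  by rewrite geo; have : 0 <= 4 / 3 / 4 ^+ J :> R by [rewrite divr_ge0 ?exprn_ge0]; lra.
rewrite (_ : 64 * B * _ = 32 * B * (256 ^+ J / J%:R ^+ 3) * 2); last by ring.
rewrite ler_wpM2l// !mulr_ge0 ?invr_ge0 ?exprn_ge0//; lra.
Qed.

(** * From scattered points to a spectral inequality *)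

Lemma cos_dist_ge (R : realType) (s t d : R) :
  0 < d -> d <= s <= pi - d -> d <= t <= pi - d ->
  sin d * `|s - t| <= `|cos s - cos t|.
Proof.
move=> d0; have pi0 := pi_gt0 R.
wlog : s t / s <= t => [H sd td|].
  have [st|/ltW ts] := leP s t; first exact: H.
  by rewrite [in leLHS]distrC [leRHS]distrC; exact: H.
rewrite le_eqVlt => /predU1P[-> _ _|st]; first by rewrite !subrr normr0 mulr0.
move=> /andP[ds sd] /andP[dt td].
have [|c] := @MVT R cos (fun x => - sin x) s t st.
  by apply: continuous_subspaceT => x; exact: continuous_cos.
rewrite in_itv/= => /andP[sc ct] E.
rewrite distrC [leRHS]distrC E normrM normrN ler_wpM2r//.
apply: le_trans (ler_norm _); apply: sin_le_middle; first exact: ltW.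
by apply/andP; split; lra.
Qed.

(** Away from the ends, dividing by the sine costs [1 / sigma]. In the Lagrange formula for the
    quotient, in the variable [cos], the numerators are at most [2] and the cosine shrinks distances
    at worst by the factor [sigma * pi / L]. *)
Lemma sine_sum_lagrange_le (R : realType) (L delta m z : R) (N : nat) (a : nat -> R)
    (x : nat -> R) (sigma := sin (pi * delta / L)) :
  0 < delta -> delta <= L / 2 ->
  (forall i, (i < N)%N -> delta <= x i <= L - delta) ->
  (forall i j : 'I_N, i != j -> x i != x j) ->
  (forall i, (i < N)%N -> `|sine_sum L N a (x i)| <= m) ->
  `|sine_sum L N a z| <= \sum_(j < N) m / sigma *
     \prod_(i < N | i != j) (2 * L / (sigma * pi) * `|x j - x i|^-1).
Proof.
move=> d0 dL xd xinj xm.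
have pi0 := pi_gt0 R.
have L0 : 0 < L by lra.
have N0 : (0 < N)%N -> 0 <= m by move=> N0; apply: le_trans (xm _ N0).
have [p sp pE] := sine_sum_horner N a.
pose th (x : R) := pi * x / L.
have ssE u : sine_sum L N a u = sin (th u) * p.[cos (th u)] by exact: pE.
have th0 : 0 < th delta by rewrite divr_gt0 ?mulr_gt0.
have thle u v : u <= v -> th u <= th v.
  by move=> uv; rewrite /th ler_pM2r ?invr_gt0// ler_pM2l.
have thL u : th (L - u) = pi - th u by rewrite /th; field; rewrite gt_eqF.
have thx i : (i < N)%N -> th delta <= th (x i) <= pi - th delta.
  by move=> /xd /andP[d1 d2]; rewrite -thL !thle.
have thd2 : th delta <= pi / 2.
  by rewrite /th ler_pdivrMr// -mulrA ler_pM2l//; lra.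
have sigma0 : 0 < sigma by apply: sin_gt0_pi; rewrite -/(th delta) th0/=; lra.
have sinx i : (i < N)%N -> sigma <= sin (th (x i)).
  by move=> /thx; apply: sin_le_middle; exact: ltW.
have dist (i j : 'I_N) : sigma * pi / L * `|x j - x i| <= `|cos (th (x j)) - cos (th (x i))|.
  have := cos_dist_ge th0 (thx _ (ltn_ord j)) (thx _ (ltn_ord i)).
  rewrite (_ : th (x j) - th (x i) = pi / L * (x j - x i)); last first.
    by rewrite /th; field; rewrite gt_eqF.
  by rewrite normrM gtr0_norm ?divr_gt0// !mulrA.
have sp0 : 0 < sigma * pi / L by rewrite divr_gt0 ?mulr_gt0.
have xij (i j : 'I_N) : i != j -> 0 < `|x j - x i|.
  by move=> ij; rewrite normr_gt0 subr_eq0 eq_sym xinj.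
have yinj : injective (fun i : 'I_N => cos (th (x i))).
  move=> i j /eqP; apply: contraTeq => ij.
  rewrite -subr_eq0 -normr_gt0; apply: lt_le_trans (dist j i).
  by rewrite mulr_gt0// xij// eq_sym.
rewrite ssE (lagrange_interpolation _ sp yinj) normrM.
apply: (@le_trans _ _ (1 * `|\sum_(j < N) p.[cos (th (x j))] *
    \prod_(i < N | i != j) ((cos (th z) - cos (th (x i))) / (cos (th (x j)) - cos (th (x i))))|)).
  by rewrite ler_wpM2r// sin_max.
rewrite mul1r; apply: le_trans (ler_norm_sum _ _ _) _; apply: ler_sum => j _.
rewrite normrM; apply: ler_pM => //.
  rewrite ler_pdivlMr//; apply: le_trans (xm _ (ltn_ord j)); rewrite ssE normrM mulrC.
  by rewrite ler_wpM2r// (le_trans (sinx _ (ltn_ord j)))// ler_norm.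
rewrite normr_prod; apply: ler_prod => i ij; rewrite normr_ge0/= normrM.
rewrite (_ : 2 * L / _ * _ = 2 * (sigma * pi / L * `|x j - x i|)^-1); last first.
  have := xij _ _ ij; move: (`|x j - x i|) => q q0; move: (pi : R) pi0 => p0 p00.
  by field; rewrite !gt_eqF.
apply: ler_pM => //.
  apply: le_trans (ler_normB _ _) _; have := cos_max (th z); have := cos_max (th (x i)).
  lra.
by rewrite normfV lef_pV2 ?posrE ?normr_gt0 ?subr_eq0 ?(inj_eq yinj) 1?eq_sym// mulr_gt0// xij.
Qed.

Lemma spectral_inequality (R : realType) (L alpha c : R) (h : R -> R) :
  0 < L -> 3 / 2 < alpha -> gauge_extension (h_formula alpha) h -> 0 < c ->
  exists2 C : R, 0 < C & forall (J : nat) (E : set R), (10 <= J)%N -> E `<=` `]0, L[ ->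
      (c%:E <= hausdorff_content h E)%E ->
      forall (a : nat -> R) (m : R), 0 <= m ->
        (forall x, E x -> `|sine_sum L (16 ^ J) a x| <= m) ->
        \sum_(k < 16 ^ J) `|a k| <= expR (C * (256 ^+ J / J%:R ^+ 3)) * m.
Proof.
move=> L0 a32 hext c0.
have [delta [B [d0 dL B1 H]]] := content_scattered L0 a32 hext c0.
have pi0 := pi_gt0 R.
pose sigma := sin (pi * delta / L).
have sigma0 : 0 < sigma.
  apply: sin_gt0_pi; rewrite divr_gt0 ?mulr_gt0//= ltr_pdivrMr// ltr_pM2l//; lra.
pose q := 2 * L / (sigma * pi).
have q0 : 0 < q by rewrite divr_gt0 ?mulr_gt0.
(* With [N <= Q], the term [2] absorbs [N * N] (interpolation points and coefficients), [2 / sigma]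
   the factor of the same name, [q] the power of [q] in the products, and [64 * B] the product of
   the inverse distances. *)
exists (2 + 2 / sigma + q + 64 * B).
  by rewrite !addr_gt0 ?divr_gt0// mulr_gt0//; lra.
move=> J E J10 EL cE; have [xs sxs xsP] := H J E J10 EL cE.
have J0 : 0 < J%:R :> R by rewrite ltr0n (leq_trans _ J10).
move=> a m m0 am.
set N := (16 ^ J)%N; set Q := 256 ^+ J / J%:R ^+ 3.
have NQ : N%:R <= Q.
  rewrite ler_pdivlMr ?exprn_gt0// /N natrX (_ : 256 = 16 * 16); last by rewrite -natrM.
  rewrite exprMn ler_wpM2l ?exprn_ge0// -!natrX ler_nat.
  by rewrite (leq_trans (cube_le_exp2 J10))// leq_exp2r// (leq_trans _ J10).
have N_gt0 : (0 < N)%N by rewrite expn_gt0.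
have N1 : 1 <= N%:R :> R by rewrite ler1n.
have uxs : uniq xs.
  by apply: scattered_uniq xsP; [exact: leq_trans J10|rewrite divr_gt0// expR_gt0].
set e := expR (64 * B * Q).
have ssle z : `|sine_sum L N a z| <= N%:R * (m / sigma * (expR (q * N%:R) * e)).
  apply: (@le_trans _ _ (\sum_(j < N) m / sigma *
     \prod_(i < N | i != j) (2 * L / (sigma * pi) * `|nth 0 xs j - nth 0 xs i|^-1))).
    apply: (@sine_sum_lagrange_le _ _ delta) => //.
    - move=> i iN; have := scattered_in xsP (mem_nth 0 (_ : (i < size xs)%N)).
      by rewrite sxs => /(_ iN) [_]; rewrite /= in_itv.
    - by move=> i j ij; rewrite nth_uniq ?sxs.
    - move=> i iN; apply: am.
      by have [] := scattered_in xsP (mem_nth 0 (_ : (i < size xs)%N)); rewrite ?sxs.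
  rewrite -/q (_ : N%:R * _ = \sum_(j < N) m / sigma * (expR (q * N%:R) * e)); last first.
    by rewrite sumr_const card_ord mulr_natl.
  apply: ler_sum => j _; rewrite ler_wpM2l ?divr_ge0 ?(ltW sigma0)//.
  rewrite big_split/= ler_pM//.
  - by rewrite prodr_ge0// => i _; rewrite ltW.
  - by rewrite prodr_ge0// => i _; rewrite invr_ge0.
  - rewrite prodr_const expRM_natr.
    apply: (@le_trans _ _ (expR q ^+ #|[pred i | i != j]|)).
      rewrite lerXn2r ?nnegrE ?expR_ge0 ?(ltW q0)//.
      by apply: le_trans (expR_ge1Dx q); lra.
    rewrite ler_weXn2l//; first by rewrite -[leLHS]expR0 ler_expR ltW.
    by apply: leq_trans (max_card _) _; rewrite card_ord.
  - exact: (scattered_prod_dist _ B1 J10 sxs xsP).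
have coef k : (k < N)%N -> `|a k| <= 2 * (N%:R * (m / sigma * (expR (q * N%:R) * e))).
  apply: sine_coef_le => th thpi; have := ssle (L / pi * th).
  rewrite /sine_sum (_ : pi * (L / pi * th) / L = th)//.
  by move: (pi : R) pi0 => p p0; field; rewrite !gt_eqF.
apply: (@le_trans _ _ (\sum_(k < N) 2 * (N%:R * (m / sigma * (expR (q * N%:R) * e))))).
  by apply: ler_sum => k _; apply: coef.
rewrite sumr_const card_ord -[leLHS]mulr_natl.
have expge (u : R) : u <= expR u by apply: le_trans (expR_ge1Dx u); lra.
rewrite (_ : N%:R * _ = (N%:R * N%:R) * (2 / sigma) * expR (q * N%:R) * e * m); last first.
  by field; rewrite gt_eqF.
apply: ler_wpM2r => //; rewrite (_ : _ * Q = 2 * Q + 2 / sigma * Q + q * Q + 64 * B * Q); last by ring.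
rewrite (expRD _ (64 * B * Q)) (expRD _ (q * Q)) (expRD (2 * Q)) -/e.
apply: ler_wpM2r; first exact: expR_ge0.
apply: ler_pM; rewrite ?expR_ge0 ?mulr_ge0 ?invr_ge0 ?(ltW sigma0)//; last first.
  by rewrite ler_expR ler_wpM2l// ltW.
apply: ler_pM; rewrite ?divr_ge0 ?(ltW sigma0)//.
  have NeQ : N%:R <= expR Q by apply: le_trans NQ _; exact: expge.
  by rewrite (_ : 2 * Q = Q + Q) ?expRD ?ler_pM//; ring.
apply: le_trans (expge _) _; rewrite ler_expR ler_peMr ?divr_ge0 ?(ltW sigma0)//.
exact: le_trans N1 NQ.
Qed.

(** * Telescoping in time *)

Definition heat_eigenvalue (R : realType) (L : R) (k : nat) : R := (k%:R * pi / L) ^+ 2.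

Definition heat_sum (R : realType) (L : R) (K : nat) (a : nat -> R) (t x : R) : R :=
  sine_sum L K (fun k => a k * expR (- (heat_eigenvalue L k.+1 * t))) x.

(** The sum of the absolute coefficients at time [t]: it dominates the supremum and splits
    additively into low and high modes. *)
Definition heat_norm (R : realType) (L : R) (K : nat) (a : nat -> R) (t : R) : R :=
  \sum_(k < K) `|a k| * expR (- (heat_eigenvalue L k.+1 * t)).

Lemma heat_norm_ge0 (R : realType) (L : R) (K : nat) (a : nat -> R) (t : R) :
  0 <= heat_norm L K a t.
Proof. by apply: sumr_ge0 => k _; rewrite mulr_ge0// expR_ge0. Qed.

Lemma heat_norm_nincr (R : realType) (L s t : R) (K : nat) (a : nat -> R) :
  s <= t -> heat_norm L K a t <= heat_norm L K a s.
Proof.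
move=> st; apply: ler_sum => k _; rewrite ler_wpM2l// ler_expR lerN2.
by rewrite ler_wpM2l// sqr_ge0.
Qed.

Lemma heat_sum_le_norm (R : realType) (L t x : R) (K : nat) (a : nat -> R) :
  `|heat_sum L K a t x| <= heat_norm L K a t.
Proof.
apply: le_trans (ler_norm_sum _ _ _) _; apply: ler_sum => k _.
rewrite normrM -[leRHS]mulr1 ler_pM ?sin_max//.
by rewrite normrM (ger0_norm (expR_ge0 _)).
Qed.

(** On [E] the low part is the whole minus the high part, so the spectral estimate multiplies the
    high modes by [M] as well; their decay since time [s] has to compensate. *)
Lemma low_high_step (R : realType) (L s t M m : R) (K N : nat) (a : nat -> R) (E : set R) :
  0 < L -> s <= t -> (N <= K)%N -> 0 <= M ->
  (forall (b : nat -> R) (m : R), 0 <= m -> (forall x, E x -> `|sine_sum L N b x| <= m) ->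
     \sum_(k < N) `|b k| <= M * m) ->
  0 <= m -> (forall x, E x -> `|heat_sum L K a t x| <= m) ->
  heat_norm L K a t <=
    M * m + (M + 1) * expR (- (heat_eigenvalue L N * (t - s))) * heat_norm L K a s.
Proof.
move=> L0 st NK M0 spec m0 vm.
have pi0 := pi_gt0 R.
pose b k := a k * expR (- (heat_eigenvalue L k.+1 * t)).
pose high := \sum_(N <= k < K) `|b k|.
have bE k : `|b k| = `|a k| * expR (- (heat_eigenvalue L k.+1 * t)).
  by rewrite normrM (ger0_norm (expR_ge0 _)).
have split_norm : heat_norm L K a t = \sum_(k < N) `|b k| + high.
  rewrite /heat_norm; under eq_bigr do rewrite -bE.
  by rewrite -!(big_mkord xpredT (fun k => `|b k|)) (big_cat_nat (n := N)).
have high_le : high <= expR (- (heat_eigenvalue L N * (t - s))) * heat_norm L K a s.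
  rewrite /heat_norm -(big_mkord xpredT (fun k => `|a k| * expR (- (heat_eigenvalue L k.+1 * s)))).
  rewrite [in leRHS](big_cat_nat (n := N))//= mulrDr.
  apply: (@le_trans _ _ (0 + expR (- (heat_eigenvalue L N * (t - s))) *
     \sum_(N <= i < K) `|a i| * expR (- (heat_eigenvalue L i.+1 * s)))); last first.
    rewrite lerD2r mulr_ge0 ?expR_ge0//; apply: sumr_ge0 => k _.
    by rewrite mulr_ge0// expR_ge0.
  rewrite add0r mulr_sumr /high big_nat [leRHS]big_nat; apply: ler_sum => k /andP[Nk _].
  rewrite bE mulrCA ler_wpM2l// -expRD ler_expR.
  have : heat_eigenvalue L N <= heat_eigenvalue L k.+1.
    rewrite lerXn2r// ?nnegrE ?divr_ge0 ?mulr_ge0 ?(ltW L0) ?(ltW pi0)//.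
    by rewrite ler_pM2r ?invr_gt0// ler_pM2r// ler_nat ltnW.
  move=> lam; have := ler_wpM2r (_ : 0 <= t - s) lam; rewrite subr_ge0 => /(_ st).
  lra.
have high0 : 0 <= high by apply: sumr_ge0.
have low : \sum_(k < N) `|b k| <= M * (m + high).
  apply: spec; first exact: addr_ge0.
  move=> x Ex; have := vm x Ex.
  rewrite /heat_sum /sine_sum -/b.
  rewrite -!(big_mkord xpredT (fun k => b k * sin (k.+1%:R * (pi * x / L)))).
  rewrite (big_cat_nat (n := N) _ NK)//=.
  set u := \sum_(0 <= i < N) _; set w := \sum_(N <= i < K) _ => uw.
  rewrite (_ : u = (u + w) - w); last by ring.
  apply: le_trans (ler_normB _ _) _; rewrite lerD//.
  apply: le_trans (ler_norm_sum _ _ _) _; apply: ler_sum => k _.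
  by rewrite normrM -[leRHS]mulr1 ler_pM// sin_max.
rewrite split_norm; have := ler_wpM2l (_ : 0 <= M + 1) high_le.
rewrite addr_ge0// mulrA => /(_ isT); lra.
Qed.

(** The constants do not accumulate: as [rho i * W i.+1 <= 2^-1], the sum from [j.+1] on comes back
    with a factor at most one half, hence below [W j], and the remainder is halved at each step. *)
Lemma telescope_le (R : realType) (A c M rho W : nat -> R) (w : nat -> R) (j n : nat) :
  (forall i, 0 <= A i) -> (forall i, 0 <= c i) -> (forall i, 0 <= w i) ->
  (forall i, (j <= i < j + n)%N -> A i <= M i * c i + rho i * A i.+1) ->
  (forall i, (j <= i)%N -> [/\ 0 <= rho i, rho i <= 2^-1, rho i * W i.+1 <= 2^-1,
     1 <= W i & M i = W i * w i]) ->
  A j <= W j * (\sum_(j <= i < j + n) w i * c i) + A (j + n)%N / 2 ^+ n.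
Proof.
move=> A0 c0 w0; elim: n j => [|n IH] j H P.
  by rewrite addn0 big_geq// mulr0 add0r expr0 divr1.
have [r0 r2 rW W1 ME] := P j (leqnn j).
have Aj : A j <= M j * c j + rho j * A j.+1 by apply: H; rewrite leqnn/= addnS ltnS leq_addr.
have Aj1 : A j.+1 <= W j.+1 * (\sum_(j.+1 <= i < j.+1 + n) w i * c i) + A (j.+1 + n)%N / 2 ^+ n.
  apply: IH => i; last by move=> /ltnW; exact: P.
  by move=> /andP[ji jn]; apply: H; rewrite ltnW//= addnS -addSn.
rewrite addnS -addSn big_ltn; last by rewrite addSn ltnS leq_addr.
set S := \sum_(j.+1 <= i < j.+1 + n) _ in Aj1 *.
have S0 : 0 <= S by apply: sumr_ge0 => i _; rewrite mulr_ge0.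
have T0 : 0 <= A (j.+1 + n)%N / 2 ^+ n by rewrite divr_ge0// exprn_ge0.
have := ler_wpM2l r0 Aj1; rewrite mulrDr mulrA => rA.
have rWS := ler_wpM2r S0 rW.
have rT := ler_wpM2r T0 r2.
have WS := ler_wpM2r S0 W1.
rewrite exprS invfM [_ * (2^-1 * _)]mulrCA mulrDr mulrA -ME.
lra.
Qed.

(** With [Q = 256^j / j^3], levels [j] and [j.+1] together cost at most [exp (257 C Q)] up to
    numerical and polynomial factors, which one more [exp Q] absorbs; [256] is the growth of [N^2]
    per level. The dissipation is at least [exp (D j Q / 2)]. *)
Lemma telescope_rate (R : realType) (C D : R) :
  0 < C -> 0 < D -> exists2 j0 : nat, (10 <= j0)%N & forall j, (j0 <= j)%N ->
  (expR (C * (256 ^+ j / j%:R ^+ 3)) + 1) * expR (- (D * 256 ^+ j / (j * j.+1)%:R))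
   * (expR (C * (256 ^+ j.+1 / j.+1%:R ^+ 3)) * (j.+1 * j.+2)%:R) <= 2^-1.
Proof.
move=> C0 D0; pose c := 2 * (257 * C + 1) / D.
(* [24] ensures [4 (j + 1) (j + 2) <= j^3], and [c] makes [D j / 2] at least [257 C + 1]. *)
exists (24 + (Num.truncn c).+1)%N; first by rewrite (@leq_trans 24) ?leq_addr.
move=> j jj; have j24 : (24 <= j)%N by apply: leq_trans jj; rewrite leq_addr.
have j10 : (10 <= j)%N by apply: leq_trans j24.
have cj : c <= j%:R.
  apply: (@le_trans _ _ (Num.truncn c).+1%:R); first exact/ltW/truncnS_gt.
  by rewrite ler_nat (leq_trans _ jj)// leq_addl.
have j0 : 0 < j%:R :> R by rewrite ltr0n (leq_trans _ j24).
set Q := 256 ^+ j / j%:R ^+ 3.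
have jQ : (j ^ 3)%:R <= Q.
  rewrite /Q ler_pdivlMr ?exprn_gt0// -!natrX -natrM ler_nat (_ : 256 = 16 * 16)%N// expnMn.
  by apply: leq_mul; rewrite (leq_trans (cube_le_exp2 j10))// leq_exp2r// (leq_trans _ j24).
have Q0 : 0 < Q by apply: lt_le_trans jQ; rewrite ltr0n expn_gt0 (leq_trans _ j24).
have E1 : expR (C * Q) + 1 <= 2 * expR (C * Q).
  have : expR 0 <= expR (C * Q) by rewrite ler_expR mulr_ge0 ?ltW.
  by rewrite expR0; lra.
have E2 : expR (C * (256 ^+ j.+1 / j.+1%:R ^+ 3)) <= expR (256 * C * Q).
  rewrite ler_expR (_ : 256 * C * Q = C * (256 * Q)); last by ring.
  rewrite ler_wpM2l ?(ltW C0)// /Q exprS -[leLHS]mulrA ler_wpM2l//.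
  rewrite ler_wpM2l ?exprn_ge0//.
  by rewrite lef_pV2 ?posrE ?exprn_gt0// ler_pXn2r ?nnegrE// ler_nat.
have E3 : 4 * (j.+1 * j.+2)%:R <= expR Q.
  apply: (@le_trans _ _ Q); last by apply: le_trans (expR_ge1Dx Q); lra.
  apply: le_trans jQ; rewrite -natrM ler_nat expnS.
  apply: (@leq_trans (24 * j ^ 2)); last by rewrite leq_mul2r j24 orbT.
  by rewrite -mulnn; clear -j24; nia.
have E4 : (257 * C + 1) * Q <= D * 256 ^+ j / (j * j.+1)%:R.
  apply: (@le_trans _ _ (D * j%:R / 2 * Q)).
    by rewrite ler_wpM2r ?(ltW Q0)//; move: cj; rewrite /c ler_pdivrMr//; lra.
  rewrite (_ : D * j%:R / 2 * Q = D * 256 ^+ j * (2 * j%:R ^+ 2)^-1); last first.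
    by rewrite /Q; field; rewrite gt_eqF.
  rewrite ler_wpM2l ?mulr_ge0 ?exprn_ge0 ?(ltW D0)//.
  rewrite lef_pV2 ?posrE ?mulr_gt0 ?exprn_gt0 ?ltr0n ?muln_gt0 ?(leq_trans _ j24)//.
  rewrite -natrX -natrM ler_nat -mulnn; clear -j24; nia.
have := ler_pM (addr_ge0 (expR_ge0 _) ler01) (expR_ge0 _) E1 E2.
set X := expR (C * (256 ^+ j.+1 / _)); set Y := _ + 1 => XY.
have : Y * X * (4 * (j.+1 * j.+2)%:R) <= 2 * expR ((257 * C + 1) * Q).
  rewrite (_ : (257 * C + 1) * Q = C * Q + 256 * C * Q + Q); last by ring.
  rewrite !expRD [leRHS](_ : _ = 2 * expR (C * Q) * expR (256 * C * Q) * expR Q); last first.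
    by rewrite !mulrA.
  apply: ler_pM => //.
  by rewrite mulr_ge0 ?expR_ge0// addr_ge0 ?expR_ge0.
rewrite expRN => H.
rewrite mulrAC ler_pdivrMr ?expR_gt0//.
have : expR ((257 * C + 1) * Q) <= expR (D * 256 ^+ j / (j * j.+1)%:R) by rewrite ler_expR.
move: H; set r := (j.+1 * j.+2)%:R; rewrite (_ : Y * X * (4 * r) = 4 * (Y * (X * r))); last by ring.
lra.
Qed.

(** Zero modes are appended so that the number of modes is at least the threshold [16 ^ i] of every
    level. *)
Lemma heat_sum_widen (R : realType) (L : R) (K N : nat) (a : nat -> R)
    (a' := fun k => if (k < K)%N then a k else 0) :
  heat_sum L (K + N) a' = heat_sum L K a /\ heat_norm L (K + N) a' = heat_norm L K a.
Proof.
split.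
  apply/funext => t; apply/funext => x; rewrite /heat_sum /sine_sum.
  rewrite [RHS](big_ord_widen (K + N) (fun k =>
    a k * expR (- (heat_eigenvalue L k.+1 * t)) * sin (k.+1%:R * (pi * x / L)))) ?leq_addr//.
  by rewrite [RHS]big_mkcond; apply: eq_bigr => k _; rewrite /a'; case: ifP; rewrite ?mul0r.
apply/funext => t; rewrite /heat_norm.
rewrite [RHS](big_ord_widen (K + N) (fun k => `|a k| * expR (- (heat_eigenvalue L k.+1 * t)))) ?leq_addr//.
by rewrite [RHS]big_mkcond; apply: eq_bigr => k _; rewrite /a'; case: ifP; rewrite ?normr0 ?mul0r.
Qed.

(** Observation takes place in the later half of each interval []T / i.+1, T / i[], the earlier half
    being left to dissipation. The weights [1 / (i (i + 1))] are these half lengths divided by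
    [T / 2], whence [G]. *)
Lemma heat_sum_observability (R : realType) (L T alpha c : R) (h : R -> R) :
  0 < L -> 0 < T -> 3 / 2 < alpha -> gauge_extension (h_formula alpha) h -> 0 < c ->
  exists2 j0 : nat, (0 < j0)%N & exists2 G : R, 0 < G &
  forall E : set R, E `<=` `]0, L[ -> (c%:E <= hausdorff_content h E)%E ->
  forall (K : nat) (a : nat -> R) (e : R), 0 < e ->
  exists (n : nat) (b : nat -> R),
    [/\ forall i, 0 <= b i,
        forall i t m, (j0 <= i < j0 + n)%N -> (T / i.+1%:R + T / i%:R) / 2 < t < T / i%:R ->
          0 <= m -> (forall x, E x -> `|heat_sum L K a t x| <= m) -> b i <= m &
        heat_norm L K a T <=
          G * (\sum_(j0 <= i < j0 + n) (T / i%:R - T / i.+1%:R) / 2 * b i) + e].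
Proof.
move=> L0 T0 a32 hext c0; have pi0 := pi_gt0 R.
have [C C0 spec] := spectral_inequality L0 a32 hext c0.
pose D := (pi / L) ^+ 2 * T / 2.
have D0 : 0 < D by rewrite divr_gt0// mulr_gt0// exprn_gt0// divr_gt0.
have [j0 j10 rate] := telescope_rate C0 D0.
have j00 : (0 < j0)%N by exact: leq_trans j10.
pose M i : R := expR (C * (256 ^+ i / i%:R ^+ 3)).
pose rho i := (M i + 1) * expR (- (D * 256 ^+ i / (i * i.+1)%:R)).
pose W i := M i * (i * i.+1)%:R.
have M0 i : 0 < M i by exact: expR_gt0.
have M1 i : 1 <= M i.
  by rewrite -[leLHS]expR0 ler_expR mulr_ge0 ?(ltW C0)// divr_ge0 ?exprn_ge0.
have W1 i : (0 < i)%N -> 1 <= W i.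
  by move=> i0; rewrite -[leLHS]mulr1 ler_pM// ler1n muln_gt0 i0.
exists j0 => //; exists (W j0 * (2 / T)).
  by rewrite mulr_gt0 ?divr_gt0// (lt_le_trans _ (W1 _ _)).
move=> E EL cE K a e e0.
pose A i := heat_norm L K a (T / i%:R).
have A0 i : 0 <= A i by exact: heat_norm_ge0.
(* As [n < 2 ^ n], the [n] halvings bring the remainder below [e]. *)
pose n := (Num.truncn (heat_norm L K a 0 / e)).+1.
(* Obtained by solving the recurrence for the observed quantity, truncated at [0]: a number
   independent of time and below every bound [m] valid on [E]. *)
pose b i := Num.max 0 ((A i - rho i * A i.+1) / M i).
have tau (i : nat) : (0 < i)%N -> (T / i%:R - T / i.+1%:R) / 2 = T / 2 / (i * i.+1)%:R.
  move=> i0; have i0' : i%:R != 0 :> R by rewrite pnatr_eq0 -lt0n.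
  have i1' : i.+1%:R != 0 :> R by rewrite pnatr_eq0.
  have iE : i.+1%:R = i%:R + 1 :> R by rewrite natr1.
  by rewrite natrM; rewrite iE in i1' *; field; rewrite i0' i1'.
exists n, b; split; first by move=> i; rewrite le_max lexx.
- move=> i t m /andP[ji _] /andP[tl /ltW tu] m0 Em.
  have i0 : (0 < i)%N by exact: leq_trans ji.
  rewrite ge_max m0/= ler_pdivrMr// lerBlDr [m * _]mulrC.
  have sT : T / i.+1%:R <= t.
    apply: ltW; apply: le_lt_trans tl.
    have : T / i.+1%:R <= T / i%:R.
      by rewrite ler_wpM2l ?(ltW T0)// lef_pV2 ?posrE ?ltr0n// ler_nat.
    by move: (T / i.+1%:R) (T / i%:R) => p q; lra.
  have [vE nE] := heat_sum_widen L K (16 ^ i)%N a.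
  apply: le_trans (heat_norm_nincr L K a tu) _; rewrite /A -nE.
  apply: le_trans (low_high_step (E := E) L0 sT (leq_addl _ _) (ltW (M0 i)) _ m0 _) _.
  + by apply: spec => //; exact: leq_trans j10 ji.
  + by rewrite vE.
  rewrite lerD2l ler_wpM2r ?heat_norm_ge0// /rho ler_wpM2l ?addr_ge0 ?(ltW (M0 i))//.
  rewrite ler_expR lerN2.
  have -> : D * 256 ^+ i / (i * i.+1)%:R =
      heat_eigenvalue L (16 ^ i) * ((T / i%:R - T / i.+1%:R) / 2).
    rewrite tau// /D /heat_eigenvalue natrX (_ : 256 = 16 * 16); last by rewrite -natrM.
    rewrite !exprMn; move: (_^-1) (16 ^+ i) (pi : R) (L^-1) => p q r s; ring.
  apply: ler_wpM2l; first exact: sqr_ge0.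
  by move: tl; move: (T / i.+1%:R) (T / i%:R) => p q; lra.
apply: (@le_trans _ _ (A j0)).
  apply: heat_norm_nincr; rewrite ler_pdivrMr ?ltr0n// ler_peMr ?(ltW T0)//.
  by rewrite ler1n.
apply: (@le_trans _ _ (W j0 * (\sum_(j0 <= i < j0 + n) (i * i.+1)%:R^-1 * b i) +
    A (j0 + n)%N / 2 ^+ n)).
  apply: (@telescope_le R A b M rho W (fun i => (i * i.+1)%:R^-1)) => //.
  - by move=> i; rewrite le_max lexx.
  - move=> i _; rewrite -lerBlDr /b.
    apply: (@le_trans _ _ (M i * ((A i - rho i * A i.+1) / M i))).
      by rewrite [leRHS]mulrC divfK// gt_eqF.
    by rewrite ler_wpM2l ?(ltW (M0 i))// le_max lexx orbT.
  move=> i ji; have i0 : (0 < i)%N by exact: leq_trans ji.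
  have rho0 : 0 <= rho i by rewrite mulr_ge0 ?expR_ge0// addr_ge0// ltW.
  have rW := rate i ji; split=> //.
  - by apply: le_trans rW; rewrite -/(M i.+1) -/(rho i) -/(W i.+1) ler_peMr// W1.
  - exact: W1.
  - by rewrite /W mulfK// pnatr_eq0 -lt0n muln_gt0 i0.
rewrite lerD//.
  rewrite -mulrA ler_wpM2l; first by [].
    by rewrite (le_trans _ (W1 _ _)).
  rewrite mulr_sumr big_nat [leRHS]big_nat; apply: ler_sum => i /andP[ji _].
  rewrite tau; last exact: leq_trans ji.
  rewrite le_eqVlt; apply/orP; left; apply/eqP.
  by move: ((i * i.+1)%:R^-1) => q; field; rewrite gt_eqF.
rewrite ler_pdivrMr ?exprn_gt0//.
apply: (@le_trans _ _ (heat_norm L K a 0)); first by apply: heat_norm_nincr; rewrite divr_ge0// ltW.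
rewrite mulrC -ler_pdivrMr//; apply: ltW; apply: lt_le_trans (truncnS_gt _) _.
by rewrite -natrX ler_nat ltnW// ltn_expl.
Qed.

(** * From sine sums to solutions of the heat equation *)

(** The integral of a nonnegative function is a supremum over simple functions below it, hence
    monotone; this applies directly to suprema over an arbitrary set [E]. *)
Lemma ge0_integral_le_lower d (T : measurableType d) (R : realType)
    (mu : {measure set T -> \bar R}) (D : set T) (f g : T -> \bar R) :
  (forall x, D x -> 0 <= f x)%E -> (forall x, D x -> f x <= g x)%E ->
  (\int[mu]_(x in D) f x <= \int[mu]_(x in D) g x)%E.
Proof.
move=> f0 fg; have g0 x : D x -> (0 <= g x)%E by move=> Dx; apply: le_trans (fg x Dx); exact: f0.
rewrite !ge0_integralE//; apply: ge_ereal_sup => _ [h hf <-].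
apply: ereal_sup_ubound; exists h => // x; apply: le_trans (hf x) _.
by apply: lee_restrict => y Dy; exact: fg.
Qed.

Lemma ge0_integral_ge_steps (R : realType) (D : set R) (f : R -> \bar R) (s : seq nat)
    (I : nat -> set R) (b : nat -> R) :
  measurable D -> uniq s -> (forall i, measurable (I i)) -> (forall i, 0 <= b i) ->
  (forall i, i \in s -> I i `<=` D) ->
  (forall i j t, I i t -> I j t -> i = j) -> (forall t, D t -> 0 <= f t)%E ->
  (forall i t, i \in s -> I i t -> (b i)%:E <= f t)%E ->
  (\sum_(i <- s) (b i)%:E * lebesgue_measure (I i) <=
    \int[lebesgue_measure]_(t in D) f t)%E.
Proof.
move=> mD us mI b0 ID Iinj f0 bf.
have mg i : measurable_fun D ((fun t : R => (b i * \1_(I i) t)%:E) : R -> \bar R).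
  apply/measurable_EFinP; apply: measurable_funM; first exact: measurable_cst.
  exact: measurable_indic.
have g0 (i : nat) (t : R) : D t -> (0%E <= (b i * \1_(I i) t)%:E :> \bar R)%E by move=> _; rewrite lee_fin mulr_ge0.
pose g (t : R) : \bar R := (\sum_(i <- s) (b i * \1_(I i) t)%:E)%E.
apply: (@le_trans _ _ (\int[lebesgue_measure]_(t in D) g t)%E); last first.
  apply: ge0_integral_le_lower => [t Dt|t Dt]; first by apply: sume_ge0 => i _; exact: g0.
  have [[i is_ It]|noi] := pselect (exists2 i, i \in s & I i t); last first.
    rewrite /g big_seq big1 ?f0// => i is_; rewrite indicE memNset ?mulr0// => It.
    by apply: noi; exists i.
  rewrite /g (bigD1_seq i)//= big1 ?adde0 => [|j ji].
    by rewrite indicE mem_set// mulr1 bf.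
  rewrite indicE memNset ?mulr0// => Jt; move: ji.
  by rewrite (Iinj _ _ _ Jt It) eqxx.
rewrite /g ge0_integral_sum//.
rewrite big_seq [leRHS]big_seq; apply: lee_sum => i is_.
under eq_integral do rewrite EFinM.
rewrite ge0_integralZl ?lee_fin//; last first.
  by apply/measurable_EFinP; apply: measurable_indic; exact: mI.
rewrite integral_indic; last exact: mI.
  by rewrite setIidl//; exact: ID.
exact: mD.
Qed.

Lemma L2norm_le_sup (R : realType) (L M : R) (v : R -> R) :
  0 < L -> 0 <= M -> (forall x, 0 < x < L -> `|v x| <= M) ->
  (L2norm L v <= (M * Num.sqrt L)%:E)%E.
Proof.
move=> L0 M0 vM; rewrite /L2norm unlock /Lnorm /=.
pose w : R -> R := v \_ `]0, L[; rewrite -/w.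
have H : (\int[lebesgue_measure]_x `|(w x)%:E| `^ 2 <=
   (M ^+ 2 * L)%:E)%E.
  apply: (@le_trans _ _ (\int[lebesgue_measure]_(x in `]0%R, L[) (cst (M ^+ 2)%:E) x)%E); last first.
    rewrite integral_cst//= lebesgue_measure_itv/= lte_fin L0 oppr0 adde0.
    by rewrite EFinM.
  rewrite [leRHS]integral_mkcond; apply: ge0_integral_le_lower => [x _|x _].
    exact: poweR_ge0.
  rewrite /= /w !patchE; case: ifPn => [|_].
    rewrite inE/= in_itv/= => /vM vxM.
    by rewrite lee_fin powR_mulrn// lerXn2r// nnegrE.
  by rewrite /= normr0 powR0.
apply: (@le_trans _ _ ((M ^+ 2 * L)%:E `^ 2^-1)%E).
  apply: gt0_ler_poweR => //; rewrite in_itv/= leey andbT.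
    by apply: integral_ge0 => x _; rewrite lee_fin powR_ge0.
  by rewrite lee_fin mulr_ge0 ?exprn_ge0// ltW.
rewrite poweR_EFin lee_fin powR12_sqrt ?mulr_ge0 ?exprn_ge0 ?(ltW L0)//.
by rewrite sqrtrM ?exprn_ge0// sqrtr_sqr ger0_norm.
Qed.

(** * Regularity of finite sine sums and approximation of solutions *)

Lemma is_derive1_sum (R : realType) (F dF : nat -> R -> R) (x : R) (n : nat) :
  (forall k, is_derive x 1 (F k) (dF k x)) ->
  is_derive x 1 (fun y => \sum_(k < n) F k y) (\sum_(k < n) dF k x).
Proof.
move=> H; elim: n => [|n IH].
  by under eq_fun do rewrite big_ord0; rewrite big_ord0; exact: is_derive_cst.
under eq_fun do rewrite big_ord_recr/=; rewrite big_ord_recr/=.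
exact: is_deriveD.
Qed.

Lemma is_derive_expR_lin (R : realType) (c lam s t : R) :
  is_derive t 1 (fun t => c * expR (- (lam * (t - s)))) (- lam * (c * expR (- (lam * (t - s))))).
Proof.
rewrite [- lam * _]mulrCA; apply: is_derive1Z; rewrite mulrC.
apply: (@is_derive1_comp _ expR (fun t => - (lam * (t - s)))).
rewrite -[X in is_derive _ _ _ X]mulr1.
have -> : (fun t => - (lam * (t - s))) = (fun t => - lam * (t - s)).
  by apply/funext => y; rewrite mulNr.
apply: is_derive1Z; rewrite -[X in is_derive _ _ _ X]subr0.
exact: is_derive1B.
Qed.

Lemma is_derive_scale (R : realType) (n L x : R) :
  is_derive x 1 (fun x => n * (pi * x / L)) (n * pi / L).
Proof.
have -> : (fun x => n * (pi * x / L)) = (fun x => n * pi / L * x).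
  by apply/funext => y; rewrite mulrA mulrA mulrAC.
by rewrite -[X in is_derive _ _ _ X]mulr1; apply: is_derive1Z; exact: is_derive_id.
Qed.

Lemma is_derive_sin_lin (R : realType) (c n L x : R) :
  is_derive x 1 (fun x => c * sin (n * (pi * x / L))) (c * (n * pi / L) * cos (n * (pi * x / L))).
Proof.
rewrite -mulrA [_ * cos _]mulrC; apply: is_derive1Z.
apply: (@is_derive1_comp _ sin (fun x => n * (pi * x / L))).
exact: is_derive_scale.
Qed.

Lemma is_derive_cos_lin (R : realType) (c n L x : R) :
  is_derive x 1 (fun x => c * cos (n * (pi * x / L))) (- (c * (n * pi / L)) * sin (n * (pi * x / L))).
Proof.
rewrite (_ : - _ * _ = c * (- sin (n * (pi * x / L)) * (n * pi / L))); last by ring.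
apply: is_derive1Z; apply: (@is_derive1_comp _ cos (fun x => n * (pi * x / L))).
exact: is_derive_scale.
Qed.

Lemma heat_sum_derivatives (R : realType) (L s : R) (K : nat) (a : nat -> R) :
  exists wt wx wxx : R -> R -> R, forall t x : R,
    [/\ is_derive t 1 (fun t => heat_sum L K a (t - s) x) (wt t x),
        is_derive x 1 (heat_sum L K a (t - s)) (wx t x),
        is_derive x 1 (wx t) (wxx t x) & wt t x = wxx t x].
Proof.
pose lam k : R := heat_eigenvalue L k.+1.
pose c k t : R := a k * expR (- (lam k * (t - s))).
pose om k : R := k.+1%:R * pi / L.
exists (fun t x => \sum_(k < K) - lam k * c k t * sin (k.+1%:R * (pi * x / L))).
exists (fun t x => \sum_(k < K) c k t * om k * cos (k.+1%:R * (pi * x / L))).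
exists (fun t x => \sum_(k < K) - (c k t * om k * om k) * sin (k.+1%:R * (pi * x / L))).
move=> t x; split.
- apply: (@is_derive1_sum _ (fun k t => c k t * sin (k.+1%:R * (pi * x / L)))
    (fun k t => - lam k * c k t * sin (k.+1%:R * (pi * x / L)))) => k.
  set S := sin _; rewrite [- _ * _ * _]mulrC.
  rewrite (_ : (fun t => c k t * S) = (fun t => S * c k t)); last first.
    by apply/funext => t'; rewrite mulrC.
  by apply: is_derive1Z; exact: is_derive_expR_lin.
- apply: (@is_derive1_sum _ (fun k x => c k t * sin (k.+1%:R * (pi * x / L)))
    (fun k x => c k t * om k * cos (k.+1%:R * (pi * x / L)))) => k.
  exact: is_derive_sin_lin.
- apply: (@is_derive1_sum _ (fun k x => c k t * om k * cos (k.+1%:R * (pi * x / L)))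
    (fun k x => - (c k t * om k * om k) * sin (k.+1%:R * (pi * x / L)))) => k.
  exact: is_derive_cos_lin.
by apply: eq_bigr => k _; congr (_ * _); rewrite /lam /heat_eigenvalue -/(om k); ring.
Qed.

Lemma heat_sum_continuous (R : realType) (L s : R) (K : nat) (a : nat -> R) :
  continuous (fun p : R * R => heat_sum L K a (p.1 - s) p.2).
Proof.
move=> p; rewrite /heat_sum /sine_sum.
elim: K => [|K IH].
  by under eq_fun do rewrite big_ord0; exact: cvg_cst.
under eq_fun do rewrite big_ord_recr/=.
apply: cvgD; first exact: IH.
apply: cvgM.
  apply: cvgM; first exact: cvg_cst.
  apply: continuous_cvg; first exact: continuous_expR.
  apply: cvgN; apply: cvgM; first exact: cvg_cst.
  by apply: cvgB; [exact: cvg_fst|exact: cvg_cst].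
apply: continuous_cvg; first exact: continuous_sin.
apply: cvgM; first exact: cvg_cst.
apply: cvgM; last exact: cvg_cst.
by apply: cvgM; [exact: cvg_cst|exact: cvg_snd].
Qed.

Lemma heat_sum_boundary (R : realType) (L t : R) (K : nat) (a : nat -> R) :
  0 < L -> heat_sum L K a t 0 = 0 /\ heat_sum L K a t L = 0.
Proof.
move=> L0; split; apply: big1 => k _.
  by rewrite mulr0 mul0r mulr0 sin0 mulr0.
rewrite mulfK ?gt_eqF// mulr_natl -[pi *+ _]add0r (alternatingn (@sinDpi R)).
by rewrite sin0 mulr0 mulr0.
Qed.

(** The comparison starts at a positive time, when [u] is continuous up to the boundary; the maximum
    principle, applied to the difference with both signs, then propagates the error of the sine
    sum. *)
Lemma heat_solution_approx (R : realType) (L s T e : R) (u : R -> R -> R) :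
  0 < L -> 0 < s -> 0 < e -> heat_solution L u ->
  exists K (a : nat -> R), forall t x, s <= t <= T -> 0 <= x <= L ->
    `|u t x - heat_sum L K a (t - s) x| <= e.
Proof.
move=> L0 s0 e0 hu; have uc := heat_continuous hu.
have usc : {within `[0, L]%classic, continuous (u s)}.
  apply/subspace_continuousP => x; rewrite /= in_itv/= => xL.
  have /subspace_continuousP/(_ (s, x)) := uc; rewrite /= => /(_ (conj s0 xL)) H.
  apply/cvgrPdist_lt => r r0; move/cvgrPdist_lt: H => /(_ r r0).
  rewrite !near_withinE => -[[A B] /= [[d1 /= d10 A1] [d2 /= d20 B1]] AB].
  exists d2 => //= y xy; rewrite in_itv/= => yL.
  have := AB (s, y); apply; split => //=.
    by apply: A1; rewrite /= subrr normr0.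
  exact: B1.
have [us0 usL] := heat_boundary hu (ltW s0).
have [K [a Ha]] := sine_sum_dense L0 e0 usc us0 usL.
exists K, a.
have [vt [vx [vxx Hv]]] := heat_sum_derivatives L s K a.
pose v t x := heat_sum L K a (t - s) x.
have vs x : v s x = sine_sum L K a x.
  rewrite /v /heat_sum subrr; congr (sine_sum L K _ x); apply/funext => k.
  by rewrite mulr0 oppr0 expR0 mulr1.
have wc : {within `[s, T]%classic `*` `[0, L]%classic,
    continuous (fun p : R * R => u p.1 p.2 - v p.1 p.2)}.
  move=> p; apply: cvgB.
    apply: (continuous_subspaceW _ uc) => -[t x] /= []; rewrite !in_itv/= => /andP[st _] xL.
    by split=> //; exact: lt_le_trans st.
  apply: (@continuous_subspaceT _ _ _ (fun p : R * R => v p.1 p.2)).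
  exact: heat_sum_continuous.
have hD (t x : R) : s < t <= T -> 0 < x < L ->
    [/\ is_derive t 1 (u ^~ x) ((u ^~ x)^`()%classic t),
        is_derive x 1 (u t) ((u t)^`()%classic x),
        is_derive x 1 (u t)^`()%classic ((u t)^`(2)%classic x) &
        (u ^~ x)^`()%classic t = (u t)^`(2)%classic x].
  move=> /andP[st _] xL; have t0 : 0 < t by exact: lt_trans st.
  split.
  - by rewrite derive1E; apply: derivableP; exact: (heat_derivable_t hu).
  - by rewrite derive1E; apply: derivableP; exact: (heat_derivable_x hu).
  - rewrite derive1nS derive1n1 derive1E; apply: derivableP.
    exact: (heat_derivable_xx hu).
  - exact: (heat_eq hu).
move=> t x st xL; rewrite ler_norml lerNl opprB; apply/andP; split.
  apply: (@heat_max_principle R L s T e (fun t x => v t x - u t x)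
    (fun t x => vt t x - (u ^~ x)^`()%classic t) (fun t x => vx t x - (u t)^`()%classic x)
    (fun t x => vxx t x - (u t)^`(2)%classic x)) => //.
  - have -> : (fun p : R * R => v p.1 p.2 - u p.1 p.2) =
        (fun p : R * R => - (u p.1 p.2 - v p.1 p.2)) by apply/funext => p; rewrite opprB.
    by move=> p; apply: cvgN; exact: wc.
  - move=> t' y st' yL; have [v1 v2 v3 v4] := Hv t' y; have [u1 u2 u3 u4] := hD _ _ st' yL.
    by split; [exact: is_derive1B|exact: is_derive1B|exact: is_derive1B|rewrite v4 u4].
  - move=> t' /andP[st' _]; have t0 : 0 <= t' by rewrite ltW// (lt_le_trans s0).
    have [-> ->] := heat_boundary hu t0; have [] := heat_sum_boundary (t' - s) K a L0.
    by rewrite /v => -> ->; rewrite subrr ltW.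
  - move=> y yL; rewrite vs; apply: le_trans (Ha y yL); rewrite distrC; exact: ler_norm.
apply: (@heat_max_principle R L s T e (fun t x => u t x - v t x)
    (fun t x => (u ^~ x)^`()%classic t - vt t x) (fun t x => (u t)^`()%classic x - vx t x)
    (fun t x => (u t)^`(2)%classic x - vxx t x)) => //.
- move=> t' y st' yL; have [v1 v2 v3 v4] := Hv t' y; have [u1 u2 u3 u4] := hD _ _ st' yL.
  by split; [exact: is_derive1B|exact: is_derive1B|exact: is_derive1B|rewrite v4 u4].
- move=> t' /andP[st' _]; have t0 : 0 <= t' by rewrite ltW// (lt_le_trans s0).
  have [-> ->] := heat_boundary hu t0; have [] := heat_sum_boundary (t' - s) K a L0.
  by rewrite /v => -> ->; rewrite subrr ltW.
- move=> y yL; rewrite vs; apply: le_trans (Ha y yL); exact: ler_norm.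
Qed.

Lemma content_gt0_nonempty (R : realType) (f : R -> R) (E : set R) :
  gauge_function f -> (0 < hausdorff_content f E)%E -> E !=set0.
Proof.
move=> gf; apply: contraPP => /set0P/negP; rewrite negbK => /eqP -> /lt_geF.
have := @hausdorff_content_le_sum _ f set0 [::] gf isT.
by rewrite big_nil => -> // x.
Qed.

Lemma ereal_sup_abs_ge0 (R : realType) (E : set R) (v : R -> R) :
  E !=set0 -> (0 <= ereal_sup [set `|v x|%:E | x in E])%E.
Proof.
move=> [x0 Ex0]; apply: (@le_trans _ _ (`|v x0|%:E)%E); first by rewrite lee_fin.
by apply: ereal_sup_ubound; exists x0.
Qed.

(** The telescoping is run between [s = T / 2] and [T], for a sine sum close to [u] from time [s]
    on. The sum depends on [e] but [G] does not, so [e] can tend to [0]. *)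
Lemma heat_pointwise_observability (R : realType) (L T alpha c : R) (h : R -> R) :
  0 < L -> 0 < T -> 3 / 2 < alpha -> gauge_extension (h_formula alpha) h -> 0 < c ->
  exists2 G : R, 0 < G &
  forall E : set R, E `<=` `]0, L[ -> (c%:E <= hausdorff_content h E)%E ->
  forall u : R -> R -> R, heat_solution L u -> forall (x r : R), 0 < x < L ->
  (\int[lebesgue_measure]_(t in `]0%R, T[) ereal_sup [set `|u t x|%:E | x in E] <= r%:E)%E ->
  `|u T x| <= G * r.
Proof.
move=> L0 T0 a32 hext c0; have [gh _ _] := hext.
have T20 : 0 < T / 2 by rewrite divr_gt0.
have [j0 j00 [G G0 obs]] := heat_sum_observability L0 T20 a32 hext c0.
exists G => // E EL cE u hu x r /andP[x0 xL] Ir.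
have E0 : E !=set0.
  by apply: (content_gt0_nonempty gh); apply: lt_le_trans cE; rewrite lte_fin.
pose f (t : R) := ereal_sup [set `|u t x|%:E | x in E].
have f0 t : (0 <= f t)%E by exact: ereal_sup_abs_ge0.
set s := T / 2 in T20 obs *.
(* One [e] replaces [u T x] by the sine sum, one is the remainder of the telescoping, and [G * s]
   comes from the error in the observed values. *)
suff H e : 0 < e -> `|u T x| <= G * r + e * (2 + G * s).
  apply/ler_addgt0Pr => e e0.
  have Gs : 0 < 2 + G * s by rewrite addr_gt0// mulr_gt0.
  by have := H (e / (2 + G * s)); rewrite divfK ?gt_eqF// divr_gt0// => /(_ isT).
move=> e0.
have [K [a Ha]] := heat_solution_approx T L0 T20 e0 hu.
have [n [b [b0 bE normE]]] := obs E EL cE K a e e0.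
pose I (i : nat) : set R := `](s + (s / i.+1%:R + s / i%:R) / 2), (s + s / i%:R)[%classic.
have sle (i j : nat) : (0 < i)%N -> (i <= j)%N -> s / j%:R <= s / i%:R.
  move=> i0 ij; rewrite ler_wpM2l ?(ltW T20)// lef_pV2 ?posrE ?ltr0n//.
    by rewrite ler_nat.
  exact: leq_trans ij.
have s1 (i : nat) : s / i%:R <= s.
  have [->|i0] := posnP i; first by rewrite invr0 mulr0 ltW.
  by rewrite -[leRHS]divr1; exact: (@sle 1%N).
have sT : s + s = T by rewrite /s; field.
have s_ge0 (i : nat) : 0 <= s / i%:R by rewrite divr_ge0// ltW.
have Idisj i j t : (0 < i)%N -> (i < j)%N -> I i t -> I j t -> False.
  move=> i0 ij; rewrite /I /= !in_itv/= => /andP[it _] /andP[_ tj].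
  have := sle _ _ (ltn0Sn i) ij; have := sle _ _ i0 (leqnSn i).
  by move: it tj; move: (s / i.+1%:R) (s / i%:R) (s / j%:R) => p q w; lra.
pose bb i := Num.max 0 (b i - e).
have fbb i t : (j0 <= i < j0 + n)%N -> I i t -> ((bb i)%:E <= f t)%E.
  move=> iJ; rewrite /I/= in_itv/= => /andP[ti tI].
  have := f0 t; case ft : (f t) => [m| |] // m0; last by rewrite leey.
  rewrite lee_fin in m0; rewrite lee_fin ge_max m0/= lerBlDr.
  apply: (bE i (t - s) _ iJ); [|exact: addr_ge0 m0 (ltW e0)|].
    by move: ti tI; move: (s / i.+1%:R) (s / i%:R) => p q; lra.
  move=> y Ey; have := EL _ Ey; rewrite /= in_itv/= => /andP[y0 yL].
  have /(Ha t y) : s <= t <= T.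
    have := s1 i; have := s_ge0 i; have := s_ge0 i.+1.
    by move: ti tI; move: (s / i.+1%:R) (s / i%:R) => p q; lra.
  have y0L : 0 <= y <= L by rewrite !ltW.
  move=> /(_ y0L) Hy.
  have uy : `|u t y| <= m.
    by rewrite -lee_fin -ft; apply: ereal_sup_ubound; exists y.
  rewrite (_ : heat_sum _ _ _ _ _ = u t y - (u t y - heat_sum L K a (t - s) y)); last by ring.
  by apply: le_trans (ler_normB _ _) _; rewrite lerD.
(* Disjointness is required for all indices; index [0] is emptied because division by [0] breaks the
   ordering of the endpoints. *)
pose J i := if (0 < i)%N then I i else set0.
have iota0 i : i \in index_iota j0 (j0 + n) -> (j0 <= i < j0 + n)%N /\ J i = I i.
  by rewrite mem_index_iota => /[dup] /andP[ji _] ->; rewrite /J (leq_trans j00 ji).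
have len (i : nat) : (0 < i)%N ->
    lebesgue_measure (I i) = ((s / i%:R - s / i.+1%:R) / 2)%:E.
  move=> i0; rewrite /I lebesgue_measure_itv/= lte_fin.
  have lt_s : s / i.+1%:R < s / i%:R.
    by rewrite ltr_pM2l// ltf_pV2 ?posrE ?ltr0n// ltr_nat.
  have -> : s + (s / i.+1%:R + s / i%:R) / 2 < s + s / i%:R.
    by move: lt_s; move: (s / i.+1%:R) (s / i%:R) => p q; lra.
  rewrite -EFinB; congr EFin.
  by move: (s / i.+1%:R) (s / i%:R) => p q; field.
have steps : (\sum_(i <- index_iota j0 (j0 + n)) (bb i)%:E * lebesgue_measure (J i) <=
    \int[lebesgue_measure]_(t in `]0%R, T[) f t)%E.
  apply: ge0_integral_ge_steps => //.
  - exact: iota_uniq.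
  - by move=> i; rewrite /J; case: ifP => _; [exact: measurable_itv|exact: measurable0].
  - by move=> i; rewrite le_max lexx.
  - move=> i /iota0 [iJ ->] t; rewrite /I /= !in_itv/= => /andP[ti tI].
    have := s1 i; have := s_ge0 i; have := s_ge0 i.+1.
    by move: ti tI; move: (s / i.+1%:R) (s / i%:R) => p q; lra.
  - move=> i j t; rewrite /J; case: ifP => // i0; case: ifP => // jj0 It Jt.
    by have [ij|ji|//] := ltngtP i j; [case: (Idisj i j t)|case: (Idisj j i t)].
  - by move=> i t /iota0 [iJ ->]; exact: fbb.
have {steps}sum_le : \sum_(j0 <= i < j0 + n) (s / i%:R - s / i.+1%:R) / 2 * bb i <= r.
  rewrite -lee_fin; apply: le_trans Ir; apply: le_trans steps.
  rewrite -sumEFin big_seq [leRHS]big_seq; apply: lee_sum => i /iota0 [/andP[ji _] ->].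
  by rewrite len ?(leq_trans j00 ji)// -EFinM mulrC.
have tele : \sum_(j0 <= i < j0 + n) (s / i%:R - s / i.+1%:R) / 2 <= s.
  rewrite -mulr_suml.
  under eq_bigr do rewrite -opprB.
  rewrite sumrN telescope_sumr ?leq_addr// opprB.
  have := s1 j0; have := s_ge0 (j0 + n)%N; move: T20.
  by move: (s / _) (s / _) => p q; lra.
have sumb : \sum_(j0 <= i < j0 + n) (s / i%:R - s / i.+1%:R) / 2 * b i <= r + e * s.
  apply: (@le_trans _ _ (\sum_(j0 <= i < j0 + n) ((s / i%:R - s / i.+1%:R) / 2 * bb i +
      e * ((s / i%:R - s / i.+1%:R) / 2)))).
    rewrite big_nat [leRHS]big_nat; apply: ler_sum => i /andP[ji _].
    rewrite [e * _]mulrC -mulrDr ler_wpM2l//.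
      by rewrite divr_ge0// subr_ge0 sle// (leq_trans j00 ji).
    by rewrite -lerBlDr le_max lexx orbT.
  by rewrite big_split/= lerD// -mulr_sumr ler_wpM2l// ltW.
have HT : `|u T x - heat_sum L K a s x| <= e.
  have x0L : 0 <= x <= L by rewrite !ltW.
  have := Ha T x _ x0L; rewrite (_ : T - s = s); last by rewrite -sT addrK.
  by apply; rewrite lexx andbT -sT lerDl ltW.
have vT := heat_sum_le_norm L s x K a.
have uT : `|u T x| <= e + heat_norm L K a s.
  rewrite (_ : u T x = (u T x - heat_sum L K a s x) + heat_sum L K a s x); last by ring.
  by apply: le_trans (ler_normD _ _) _; rewrite lerD.
apply: le_trans uT _; have := ler_wpM2l (ltW G0) sumb; move: normE.
set S := \sum_(_ <= _ < _) _; lra.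
Qed.

Lemma observability_of_content (R : realType) (L alpha : R) (h : R -> R) :
  0 < L -> 3 / 2 < alpha -> gauge_extension (h_formula alpha) h ->
  forall (T : R) (c : \bar R), 0 < T -> (0 < c)%E ->
  exists C : R, 0 < C /\
    forall E : set R, E `<=` `]0, L[ -> hausdorff_content h E = c ->
      observability L T E C.
Proof.
move=> L0 a32 hext T c T0 c0; have [gh _ _] := hext.
have [c' c'0 c'c] : exists2 c' : R, 0 < c' & (c'%:E <= c)%E.
  by case: c c0 => [c| |] // c0; [exists c|exists 1; rewrite ?leey].
have [G G0 obs] := heat_pointwise_observability L0 T0 a32 hext c'0.
exists (G * Num.sqrt L); split; first by rewrite mulr_gt0 ?sqrtr_gt0.
move=> E EL cE u hu.
have c'E : (c'%:E <= hausdorff_content h E)%E by rewrite cE.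
have E0 : E !=set0 by apply: (content_gt0_nonempty gh); rewrite cE.
have I0 : (0 <= \int[lebesgue_measure]_(t in `]0%R, T[) ereal_sup [set `|u t x|%:E | x in E])%E.
  by apply: integral_ge0 => t _; exact: ereal_sup_abs_ge0.
have := obs E EL c'E u hu.
case: (\int[lebesgue_measure]_(t in _) _)%E I0 => [r| |] // I0 H.
  have r0 : 0 <= r by rewrite -lee_fin.
  rewrite -EFinM mulrAC; apply: L2norm_le_sup => //; first by rewrite mulr_ge0// ltW.
  by move=> x xL; apply: H.
by rewrite gt0_muley ?leey// lte_fin mulr_gt0 ?sqrtr_gt0.
Qed.

(** * A set of positive content *)

Lemma powR_eventually_ge (R : realType) (B r : R) : 0 < r ->
  exists N0 : nat, forall N : nat, (N0 <= N)%N -> B <= N%:R `^ r.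
Proof.
move=> r0; exists (Num.truncn ((Num.max B 0) `^ r^-1)).+1 => N NN.
have B0 : 0 <= Num.max B 0 by rewrite le_max lexx orbT.
apply: (@le_trans _ _ (Num.max B 0)); first by rewrite le_max lexx.
have BE : Num.max B 0 = ((Num.max B 0) `^ r^-1) `^ r.
  by rewrite -powRrM mulVf ?gt_eqF// powRr1.
rewrite [leLHS]BE.
apply: ge0_ler_powR; rewrite ?nnegrE ?powR_ge0// ?(ltW r0)//.
by apply: le_trans (ltW (truncnS_gt _)) _; rewrite ler_nat.
Qed.

(* With [p = 2 + eps / 2] and [q = 2 + eps], this is the [K] such that
   [1 - K^-1] is the midpoint of [p / q] and [1]: a cell contains about
   [N `^ (1 - K^-1)] cells of the next frequency [N], more than the
   [O(N `^ (p / q))] balls of a cover of small cost to be avoided there. *)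
Definition gap_exponent (R : realType) (eps : R) : R :=
  2 / (1 - (2 + eps / 2) / (2 + eps)).

Definition cell_radius (R : realType) (eps : R) (N : nat) : R :=
  expR (- (N%:R `^ (2 + eps / 2))).

Definition next_frequency (R : realType) (eps : R) (N : nat) : nat :=
  (Num.truncn (expR (gap_exponent eps * N%:R `^ (2 + eps / 2)))).+1.

Lemma gap_exponent_ge2 (R : realType) (eps : R) : 0 < eps ->
  0 < (2 + eps / 2) / (2 + eps) < 1 /\ 2 <= gap_exponent eps.
Proof.
move=> e0; have q0 : 0 < 2 + eps by lra.
have /andP[a0 a1] : 0 < (2 + eps / 2) / (2 + eps) < 1.
  by apply/andP; split; [rewrite divr_gt0//; lra|rewrite ltr_pdivrMr//; lra].
rewrite a0 a1; split=> //; rewrite /gap_exponent ler_pdivlMr; lra.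
Qed.

Lemma next_frequency_gt (R : realType) (eps : R) (N : nat) : 0 < eps ->
  (N < next_frequency eps N)%N.
Proof.
move=> e0; rewrite -(ltr_nat R); apply: le_lt_trans (truncnS_gt _).
have [_ K2] := gap_exponent_ge2 e0.
case: N => [|N]; first exact: expR_ge0.
apply: le_trans (expR_ge1Dx _).
have : N.+1%:R <= N.+1%:R `^ (2 + eps / 2) :> R by apply: le1r_powR; rewrite ?ler1n//; lra.
have := ler_wpM2r (powR_ge0 N.+1%:R (2 + eps / 2)) K2.
have : 0 <= N.+1%:R :> R by [].
move: (N.+1%:R) => n; lra.
Qed.

Lemma next_frequency_bounds (R : realType) (eps : R) (N : nat) :
  let X := expR (gap_exponent eps * N%:R `^ (2 + eps / 2)) in
  X <= (next_frequency eps N)%:R <= X + 1.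
Proof.
apply/andP; split; first exact/ltW/truncnS_gt.
by rewrite -[leLHS]natr1 lerD2r truncn_le expR_ge0.
Qed.

Lemma cell_radius_le (R : realType) (L eps : R) : 0 < L -> 0 < eps ->
  exists N0 : nat, forall N, (N0 <= N)%N -> 4 * N%:R * cell_radius eps N <= L.
Proof.
move=> L0 e0; exists (Num.truncn (4 / L)).+1 => N NN.
have N4 : 4 / L <= N%:R by apply: le_trans (ltW (truncnS_gt _)) _; rewrite ler_nat.
have N1 : 1 <= N%:R :> R by rewrite ler1n (leq_trans _ NN).
rewrite /cell_radius expRN ler_pdivrMr ?expR_gt0//.
rewrite ler_pdivrMr// in N4.
apply: (@le_trans _ _ (L * N%:R ^+ 2)).
  by rewrite expr2 mulrA ler_wpM2r// mulrC; lra.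
rewrite ler_wpM2l ?(ltW L0)//; apply: (@le_trans _ _ (N%:R `^ (2 + eps / 2))).
  rewrite -powR_mulrn//; apply: ler_powR => //; lra.
by apply: le_trans (expR_ge1Dx _); rewrite lerDr.
Qed.

Lemma f_formula_le (R : realType) (eps s t : R) : 0 < eps -> 1 < s^-1 -> s^-1 <= expR t ->
  t `^ (- (2 + eps)^-1) <= f_formula eps s.
Proof.
move=> e0 s1 st; rewrite /f_formula.
have s0 : 0 < s^-1 by apply: lt_trans s1.
have ls : 0 < ln s^-1 by exact: ln_gt0.
have lt : ln s^-1 <= t by rewrite -[leRHS]expRK ler_ln ?posrE ?expR_gt0.
have t0 : 0 < t by exact: lt_le_trans lt.
rewrite !powRN lef_pV2 ?posrE ?powR_gt0//.
by apply: ge0_ler_powR => //; rewrite ?nnegrE ?ltW// invr_gt0; lra.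
Qed.

(** For consecutive frequencies [N], [M], [M'], a ball of diameter about [L / M'] costs at least of
    order [M^(-p/q)], since [log M'] is of order [M^p]; so [n] of order [M^(p/q)] balls exhaust the
    budget [1]. A cell of level [N] is longer than [M^(-1/K)] and contains of order [M^(1 - 1/K)]
    lattice steps. *)
Lemma cell_count (R : realType) (L eps : R) (f : R -> R) :
  0 < L -> 0 < eps -> gauge_extension (f_formula eps) f ->
  exists N0 : nat, forall N, (N0 <= N)%N -> let N' := next_frequency eps N in
    exists n : nat, 1 <= n%:R * f (L / (2 * (next_frequency eps N')%:R)) /\
      n.+1%:R * L <= N'%:R * cell_radius eps N.
Proof.
move=> L0 e0 [_ fE _].
pose p := 2 + eps / 2; pose q := 2 + eps; pose a := p / q; pose K := gap_exponent eps.
have [/andP[a0 a1] K2] := gap_exponent_ge2 e0.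
rewrite -/p -/q -/a in a0 a1; rewrite -/K in K2.
have K0 : 0 < K by lra.
have q0 : 0 < q by rewrite /q; lra.
have p0 : 0 < p by rewrite /p; lra.
have p1 : 1 <= p by rewrite /p; lra.
pose B := ((2 * K) `^ q^-1 + 2) * L.
have [N1 HN1] := @powR_eventually_ge _ B ((1 - a) / 2) ltac:(by rewrite divr_gt0// subr_gt0).
exists (maxn N1 (maxn (Num.truncn (4 / L)).+1 (Num.truncn (expR 3 * L)).+1)) => N.
rewrite !geq_max => /and3P[N1N N2N N3N] /=.
have := next_frequency_bounds eps N; have := next_frequency_gt N e0.
move: (next_frequency eps N) => M NM /= /andP[M_ge _].
have := next_frequency_bounds eps M; have := next_frequency_gt M e0.
move: (next_frequency eps M) => M' MM /= /andP[_ M'_le].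
rewrite -/p -/K in M_ge M'_le.
have M1 : 1 <= M%:R :> R by rewrite ler1n (leq_trans _ NM).
have M0 : 0 < M%:R :> R by apply: lt_le_trans M1.
have M'0 : 0 < M'%:R :> R by rewrite ltr0n (leq_trans _ MM).
have M4 : 4 <= M%:R * L.
  rewrite -ler_pdivrMr//; apply: le_trans (ltW (truncnS_gt _)) _.
  by rewrite ler_nat (leq_trans N2N)// ltnW.
have M3 : expR 3 * L <= M'%:R.
  apply: le_trans (ltW (truncnS_gt _)) _; rewrite ler_nat (leq_trans N3N)// ltnW//.
  exact: ltn_trans MM.
set X : R := M%:R `^ p.
have X0 : 0 < X by rewrite powR_gt0.
have MX : M%:R <= X by apply: le1r_powR.
set s := L / (2 * M'%:R).
have s0 : 0 < s by rewrite divr_gt0// mulr_gt0.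
have sE : s^-1 = 2 * M'%:R / L by rewrite /s invf_div.
have e30 : 0 < expR 3 :> R by exact: expR_gt0.
have s3 : s <= expR (- 3).
  rewrite expRN -[leLHS]invrK lef_pV2 ?posrE ?invr_gt0// sE ler_pdivlMr//.
  by apply: le_trans M3 _; lra.
have s1 : 1 < s^-1.
  by rewrite invf_gt1//; apply: le_lt_trans s3 _; rewrite expR_lt1; lra.
have sX : s^-1 <= expR (2 * K * X).
  have M'X : M'%:R <= expR (K * X) + 1 by [].
  have KX1 : 1 <= expR (K * X) by rewrite -[leLHS]expR0 ler_expR mulr_ge0// ltW.
  have KX4 : 4 <= expR (K * X) * L.
    apply: le_trans M4 _; rewrite ler_wpM2r ?(ltW L0)//.
    apply: le_trans MX _; apply: le_trans (expR_ge1Dx _).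
    have := ler_wpM2r (ltW X0) K2; lra.
  rewrite sE ler_pdivrMr// (_ : 2 * K * X = K * X + K * X); last by ring.
  rewrite expRD; have := ler_wpM2l (expR_ge0 (K * X)) KX4.
  by move: KX1 M'X; move: (expR _) (M'%:R) => y m; lra.
have fs : (2 * K * X) `^ (- q^-1) <= f s.
  by rewrite fE//; exact: f_formula_le.
set Y : R := (2 * K * X) `^ q^-1.
have Y0 : 0 < Y by rewrite powR_gt0// mulr_gt0// mulr_gt0.
exists (Num.truncn Y).+1; split.
  apply: (@le_trans _ _ (Y * Y^-1)); first by rewrite divff// gt_eqF.
  by rewrite ler_pM ?invr_ge0 ?(ltW Y0)// -?powRN// ltW// truncnS_gt.
have nY : (Num.truncn Y).+2%:R <= Y + 2.
  by rewrite -[_.+2]addn2 natrD lerD2r truncn_le ltW.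
have YE : Y = (2 * K) `^ q^-1 * M%:R `^ a.
  have K20 : 0 <= 2 * K by rewrite mulr_ge0// ltW.
  by rewrite /Y (powRM _ K20 (ltW X0)) /a powRrM.
have Ma1 : 1 <= M%:R `^ a by rewrite -[leLHS](powRr0 M%:R) ler_powR// ltW.
have rad : M%:R `^ (- K^-1) <= cell_radius eps N.
  rewrite /cell_radius -/p expRN powRN lef_pV2 ?posrE ?powR_gt0 ?expR_gt0//.
  have -> : expR (N%:R `^ p) = (expR (K * N%:R `^ p)) `^ K^-1.
    by rewrite -expRM mulrAC divff ?gt_eqF// mul1r.
  apply: ge0_ler_powR; rewrite ?nnegrE ?powR_ge0 ?invr_ge0 ?(ltW K0)//.
apply: (@le_trans _ _ (M%:R * M%:R `^ (- K^-1))); last by rewrite ler_wpM2l// ltW.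
(* [1 - K^-1 = a + (1 - a) / 2]; the surplus [(1 - a) / 2] absorbs the constant [B]. *)
have -> : M%:R * M%:R `^ (- K^-1) = M%:R `^ a * M%:R `^ ((1 - a) / 2).
  rewrite -[X in X * _](powRr1 (ltW M0)) -!powRD ?(gt_eqF M0) ?implybT//.
  by congr (_ `^ _); rewrite /K /gap_exponent -/p -/q -/a invf_div; field.
apply: (@le_trans _ _ (M%:R `^ a * B)).
  rewrite /B mulrA ler_wpM2r ?(ltW L0)//; apply: le_trans nY _.
  by rewrite YE; lra.
by rewrite ler_wpM2l ?powR_ge0// HN1// (leq_trans N1N)// ltnW.
Qed.

Lemma sum_injective_le_nneseries (R : realType) (u : nat -> R) (j : nat -> nat) (n : nat) :
  (forall k, 0 <= u k) ->
  (forall i i', (i < n)%N -> (i' < n)%N -> j i = j i' -> i = i') ->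
  ((\sum_(i < n) u (j i))%:E <= \sum_(0 <= k <oo) (u k)%:E)%E.
Proof.
move=> u0 jinj.
have [M jM] : exists M, forall i, (i < n)%N -> (j i < M)%N.
  exists (\max_(i < n) j i).+1 => i ni.
  by rewrite ltnS (leq_bigmax (Ordinal ni)).
apply: (@le_trans _ _ (\sum_(0 <= k < M) (u k)%:E)%E); last first.
  by apply: nneseries_lim_ge => k _ _; rewrite lee_fin.
rewrite sumEFin lee_fin.
have us : uniq [seq j i | i <- iota 0 n].
  by rewrite map_inj_in_uniq ?iota_uniq// => i i'; rewrite !mem_iota => /= ni ni'; exact: jinj.
rewrite -(big_mkord xpredT (fun i => u (j i))) /index_iota subn0 -(big_map j xpredT u).
rewrite (perm_big [seq k <- iota 0 (M - 0) | k \in [seq j i | i <- iota 0 n]]) /=; last first.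
  apply: uniq_perm => //; first by rewrite filter_uniq// iota_uniq.
  move=> k; rewrite mem_filter mem_iota add0n subn0 /=.
  case: (boolP (k \in _)) => //= /mapP[i]; rewrite mem_iota => /= ni ->.
  by rewrite jM.
by rewrite big_filter big_mkcond; apply: ler_sum => k _; case: ifP.
Qed.

(** Pigeonhole: balls of diameter below [h / 2] hitting different cells are different, because the
    cells are at least [h - d' >= h / 2] apart. If all [n] cells were hit by balls of diameter at
    least [lo], the cost would reach [n * f lo >= 1]. *)
Lemma select_cell (R : realType) (f : R -> R) (h y d d' lo : R) (n : nat) (x r : nat -> R) :
  gauge_function f -> 0 < h -> 0 <= y -> 0 < lo -> d' <= h / 2 -> n.+1%:R * h <= d ->
  1 <= n%:R * f lo -> (forall j, 0 < r j) ->
  (\sum_(0 <= j <oo) (f (2 * r j))%:E < 1)%E ->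
  exists m : nat, [/\ y <= m%:R * h, m%:R * h + d' <= y + d &
    forall j z, lo <= 2 * r j -> 2 * r j < h / 2 -> m%:R * h <= z <= m%:R * h + d' ->
      r j <= `|x j - z|].
Proof.
move=> gf h0 y0 lo0 d'h nd nf r0 sum1.
apply: contrapT => nom.
(* Reaching the first lattice point beyond [y] wastes at most one step, whence [n.+1] steps for [n]
   cells. *)
pose m i := ((Num.truncn (y / h)).+1 + i)%N.
have /andP[ty yt] : (Num.truncn (y / h))%:R * h <= y < (Num.truncn (y / h)).+1%:R * h.
  by rewrite -ler_pdivlMr// -ltr_pdivrMr// truncn_itv// divr_ge0// ltW.
have mE i : (m i)%:R * h = (Num.truncn (y / h)).+1%:R * h + i%:R * h.
  by rewrite natrD mulrDl.
have m1 i : y <= (m i)%:R * h.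
  by rewrite mE; apply: le_trans (ltW yt) _; rewrite lerDl mulr_ge0// ltW.
have m2 i : (i < n)%N -> (m i)%:R * h + d' <= y + d.
  move=> ni; have : i.+1%:R * h <= n%:R * h by rewrite ler_pM2r// ler_nat.
  move: nd; rewrite mE -[n.+1]addn1 -[i.+1]addn1 -[_.+1]addn1 !natrD !mulrDl; lra.
have hit i : exists j, (i < n)%N -> [/\ lo <= 2 * r j, 2 * r j < h / 2 &
    exists2 z, (m i)%:R * h <= z <= (m i)%:R * h + d' & `|x j - z| < r j].
  have [ni|] := ltnP i n; last by exists 0%N.
  apply: contrapT => noj; apply: nom; exists (m i); split=> //; first exact: m2.
  move=> j z loj jh zm; rewrite leNgt; apply/negP => xz.
  by apply: noj; exists j => _; split=> //; exists z.
have [j jP] := choice hit.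
have far (i i' : nat) : (i < i')%N -> (m i)%:R * h + h <= (m i')%:R * h.
  move=> ii'; rewrite !mE -addrA lerD2l.
  have : i.+1%:R * h <= i'%:R * h by rewrite ler_pM2r// ler_nat.
  by rewrite -natr1 mulrDl mul1r.
have apart i i' : (i < n)%N -> (i' < n)%N -> (i < i')%N -> j i <> j i'.
  move=> ni ni' ii' jj; have [_ _ [z /andP[z1 z2] xz]] := jP i ni.
  have [_ jh [z' /andP[z1' z2'] xz']] := jP i' ni'; rewrite jj in xz.
  have := far _ _ ii'; have := ler_norm (z' - z).
  have : `|z' - z| < 2 * r (j i').
    rewrite (_ : z' - z = (x (j i') - z) - (x (j i') - z')); last by ring.
    by apply: le_lt_trans (ler_normB _ _) _; lra.
  lra.
have f0 k : 0 <= f (2 * r k) by apply: (gauge_ge0 gf); rewrite mulr_gt0.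
have jinj i i' : (i < n)%N -> (i' < n)%N -> j i = j i' -> i = i'.
  move=> ni ni' jj; have [ii|ii|//] := ltngtP i i'.
    by case: (apart i i' ni ni' ii).
  by case: (apart i' i ni' ni ii).
have /le_lt_trans/(_ sum1) := sum_injective_le_nneseries f0 jinj.
rewrite lte_fin ltNge => /negP; apply; apply: le_trans nf _.
rewrite (_ : n%:R * f lo = \sum_(i < n) f lo); last first.
  by rewrite sumr_const card_ord mulr_natl.
apply: ler_sum => i _; have [+ _ _] := jP i (ltn_ord i).
rewrite le_eqVlt => /predU1P[->//|]; move=> /(gauge_increasing gf lo0); exact: ltW.
Qed.

(** * Nested cells and the content of the thin set *)

Definition thin_set (R : realType) (L eps : R) (N : nat -> nat) : set R :=
  [set x | 0 < x < L /\
    forall k, exists m : nat, `|x - m%:R * (L / (N k)%:R)| <= cell_radius eps (N k)].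

Definition frequencies (R : realType) (eps : R) (N0 k : nat) : nat :=
  iter k (next_frequency eps) N0.

Lemma frequencies_ge (R : realType) (eps : R) (N0 k : nat) : 0 < eps ->
  (N0 + k <= frequencies eps N0 k)%N.
Proof.
move=> e0; elim: k => [|k IH]; first by rewrite addn0.
by rewrite addnS (leq_ltn_trans IH)//= next_frequency_gt.
Qed.

Lemma thin_set_content_gt0 (R : realType) (L eps : R) (f : R -> R) :
  0 < L -> 0 < eps -> gauge_extension (f_formula eps) f ->
  exists N0 : nat, (0 < hausdorff_content f (thin_set L eps (frequencies eps N0)))%E.
Proof.
move=> L0 e0 fext; have [gf _ _] := fext.
have [N1 HN1] := cell_radius_le L0 e0.
have [N2 HN2] := cell_count L0 e0 fext.
pose N0 := (2 + maxn N1 N2)%N; exists N0; pose N := frequencies eps N0.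
have NS k : N k.+1 = next_frequency eps (N k) by [].
have Nge k : (N0 + k <= N k)%N by exact: frequencies_ge.
have N2k k : (2 <= N k)%N by rewrite (leq_trans _ (Nge k))// -addnA leq_addr.
have NN k : (maxn N1 N2 <= N k)%N by rewrite (leq_trans _ (Nge k))// addnAC leq_addl.
have Npos k : 0 < (N k)%:R :> R by rewrite ltr0n (leq_trans _ (N2k k)).
pose h k : R := L / (N k)%:R.
have h0 k : 0 < h k by rewrite divr_gt0.
pose d k := cell_radius eps (N k).
have d0 k : 0 < d k by exact: expR_gt0.
have dh k : d k <= h k / 4.
  rewrite /h mulrAC ler_pdivlMr// ler_pdivlMr//.
  have := HN1 (N k); rewrite (leq_trans (leq_maxl _ _) (NN k)) => /(_ isT).
  by rewrite -/(d k); move: (d k) ((N k)%:R) => a b; lra.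
have f_gt0 t : 0 < t -> 0 < f t.
  move=> t0; have t20 : 0 < t / 2 by rewrite divr_gt0.
  by apply: le_lt_trans (gauge_ge0 gf t20) (gauge_increasing gf t20 _); lra.
have h20 k : 0 < h k / 2 by rewrite divr_gt0.
(* The bound [f (h 1 / 2)] excludes the balls of diameter at least [h 1 / 2], which no selection of
   cells handles; [1] is the budget of [select_cell]. *)
pose c0 := Num.min 1 (f (h 1%N / 2)).
have c0_gt0 : 0 < c0 by rewrite lt_min ltr01 f_gt0.
apply: (@lt_le_trans _ _ c0%:E); first by rewrite lte_fin.
rewrite leNgt; apply/negP => /ereal_inf_lt[_ [x [r [r0 cover ->]]] sumc].
have sum1 : (\sum_(0 <= j <oo) (f (2 * r j))%:E < 1)%E.
  by apply: lt_le_trans sumc _; rewrite lee_fin ge_min lexx.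
have step (km : nat * nat) : exists m' : nat,
    let y := km.2%:R * h km.1 in let k := km.1.+1 in
    [/\ y <= m'%:R * h k, m'%:R * h k + d k <= y + d km.1 &
    forall j z, h k.+1 / 2 <= 2 * r j -> 2 * r j < h k / 2 ->
      m'%:R * h k <= z <= m'%:R * h k + d k -> r j <= `|x j - z|].
  case: km => k m /=; have [|n [nf nd]] := HN2 (N k).
    by rewrite (leq_trans (leq_maxr _ _) (NN k)).
  apply: (select_cell (n := n) x gf (h0 k.+1)) => //.
  - by rewrite mulr_ge0// ltW.
  - by apply: le_trans (dh _) _; have := h0 k.+1; lra.
  - rewrite /h mulrA ler_pdivrMr//; move: nd; rewrite -NS [_ * cell_radius _ _]mulrC.
    exact.
  - move: nf; rewrite -!NS /h.
    by rewrite (_ : L / _ / 2 = L / (2 * (N k.+2)%:R))// invfM mulrA mulrAC.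
have [g gP] := choice step.
(* The first cell starts at [L / N 0] and not at [0]; as [N 0 >= 2], it lies inside the open
   interval. *)
pose m := fix m k := if k is k'.+1 then g (k', m k') else 1%N.
pose y k := (m k)%:R * h k.
have yP k : [/\ y k <= y k.+1, y k.+1 + d k.+1 <= y k + d k &
    forall j z, h k.+2 / 2 <= 2 * r j -> 2 * r j < h k.+1 / 2 ->
      y k.+1 <= z <= y k.+1 + d k.+1 -> r j <= `|x j - z|].
  exact: (gP (k, m k)).
have y_nd i k : (i <= k)%N -> y i <= y k.
  move=> /subnKC <-; elim: (k - i)%N => [|n IH]; first by rewrite addn0.
  by rewrite addnS; apply: le_trans IH _; have [] := yP (i + n)%N.
have yd_ni i k : (i <= k)%N -> y k + d k <= y i + d i.
  move=> /subnKC <-; elim: (k - i)%N => [|n IH]; first by rewrite addn0.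
  by rewrite addnS; apply: le_trans IH; have [] := yP (i + n)%N.
have yub k i : y i <= y k + d k.
  have [ik|/ltnW ki] := leqP i k.
    by apply: le_trans (y_nd _ _ ik) _; rewrite lerDl ltW.
  by apply: le_trans (yd_ni _ _ ki); rewrite lerDl ltW.
pose z := sup (range y).
have yz k : y k <= z <= y k + d k.
  apply/andP; split.
    apply: ub_le_sup; last by exists k.
    by exists (y 0%N + d 0%N) => _ [i _ <-].
  by apply: ge_sup; [exists (y 0%N); exists 0%N|move=> _ [i _ <-]].
have Ez : thin_set L eps N z.
  split.
    have /andP[z1 z2] := yz 0%N; have := dh 0%N; have := h0 0%N.
    have y0 : y 0%N = h 0%N by rewrite /y mul1r.
    have hL : h 0%N <= L / 2.
      by rewrite /h ler_wpM2l ?(ltW L0)// lef_pV2 ?posrE// ler_nat.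
    by rewrite y0 in z1 z2; move=> ? ?; apply/andP; split; lra.
  move=> k; exists (m k); rewrite -/(h k) -/(y k) -/(d k).
  by have /andP[z1 z2] := yz k; rewrite ger0_norm ?subr_ge0// lerBlDl.
have [j _ zj] := cover _ Ez; rewrite /ball/= in zj.
have rj0 := r0 j.
have t_lt : 2 * r j < h 1%N / 2.
  rewrite ltNge; apply/negP => ht.
  have : f (h 1%N / 2) <= f (2 * r j).
    move: ht; rewrite le_eqVlt => /predU1P[->//|].
    by move=> /(gauge_increasing gf (h20 1%N)); exact: ltW.
  apply/negP; rewrite -ltNge -lte_fin; apply: (@lt_le_trans _ _ c0%:E).
    apply: le_lt_trans sumc.
    have f0 k : 0 <= f (2 * r k) by apply: (gauge_ge0 gf); rewrite mulr_gt0.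
    have /= := @sum_injective_le_nneseries _ (fun k => f (2 * r k)) (fun=> j) 1 f0.
    by rewrite big_ord_recl big_ord0 addr0; apply => -[|?] [|?].
  by rewrite lee_fin ge_min lexx orbT.
have exk : exists k, h k.+1 / 2 <= 2 * r j.
  exists (Num.truncn (L / (4 * r j))).+1; set k := (Num.truncn _).+1.
  have kN : k%:R <= (N k.+1)%:R :> R.
    by rewrite ler_nat (leq_trans _ (Nge k.+1))// (leq_trans (leqnSn k))// leq_addl.
  have : L / (4 * r j) <= (N k.+1)%:R by apply: le_trans kN; exact/ltW/truncnS_gt.
  rewrite ler_pdivrMr ?mulr_gt0// /h ler_pdivrMr// ler_pdivrMr//.
  by move: ((N k.+1)%:R) => a; lra.
(* The least index puts the diameter of this ball between two consecutive half steps, a band avoided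
   by the cell chosen at that stage, which contains [z]. *)
case: (ex_minnP exk) => -[|k] hk kmin; first by move: hk; rewrite leNgt t_lt.
have hk' : 2 * r j < h k.+1 / 2.
  by rewrite ltNge; apply/negP => /kmin; rewrite ltnn.
have [_ _ /(_ j z hk hk' (yz k.+1))] := yP k.
by rewrite leNgt zj.
Qed.

(** * Failure of observability *)

Definition eigenmode (R : realType) (L : R) (n : nat) (t x : R) : R :=
  expR (- (heat_eigenvalue L n * t)) * sin (n%:R * (pi * x / L)).

Lemma eigenmode_continuous (R : realType) (L k : R) (n : nat) (g : R -> R) :
  continuous g ->
  continuous (fun p : R * R =>
    k * (expR (- (heat_eigenvalue L n * p.1)) * g (n%:R * (pi * p.2 / L)))).
Proof.
move=> gc p; apply: cvgM; first exact: cvg_cst.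
apply: cvgM.
  apply: continuous_cvg; first exact: continuous_expR.
  by apply: cvgN; apply: cvgM; [exact: cvg_cst|exact: cvg_fst].
apply: continuous_cvg; first exact: gc.
apply: cvgM; first exact: cvg_cst.
apply: cvgM; last exact: cvg_cst.
by apply: cvgM; [exact: cvg_cst|exact: cvg_snd].
Qed.

Lemma eigenmode_derivatives (R : realType) (L : R) (n : nat)
    (lam := heat_eigenvalue L n) (om := n%:R * pi / L) :
  [/\ forall t x : R, is_derive t 1 (eigenmode L n ^~ x) (- lam * eigenmode L n t x),
      forall t x : R, is_derive x 1 (eigenmode L n t)
        (om * (expR (- (lam * t)) * cos (n%:R * (pi * x / L)))) &
      forall t x : R, is_derive x 1
        (fun x => om * (expR (- (lam * t)) * cos (n%:R * (pi * x / L))))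
        (- lam * eigenmode L n t x)].
Proof.
split=> t x.
- have := @is_derive_expR_lin _ (sin (n%:R * (pi * x / L))) lam 0 t; rewrite subr0.
  under eq_fun do rewrite subr0 mulrC.
  by rewrite [sin _ * _]mulrC.
- rewrite mulrA [om * _]mulrC; exact: is_derive_sin_lin.
rewrite (_ : - lam * _ = - (om * expR (- (lam * t)) * om) * sin (n%:R * (pi * x / L))); last first.
  by rewrite /eigenmode -/lam /lam /heat_eigenvalue -/om; ring.
have := is_derive_cos_lin (om * expR (- (lam * t))) n%:R L x.
by under eq_fun do rewrite -mulrA.
Qed.

Lemma eigenmode_solution (R : realType) (L : R) (n : nat) :
  0 < L -> heat_solution L (eigenmode L n).
Proof.
move=> L0; have pi0 := pi_gt0 R.
pose lam := heat_eigenvalue L n; pose om := n%:R * pi / L.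
have [dt dx dxx] := eigenmode_derivatives L n.
have tE t x : (eigenmode L n ^~ x)^`()%classic t = - lam * eigenmode L n t x.
  by rewrite derive1E (@derive_val _ _ _ _ _ _ _ (dt t x)).
have xE t : (eigenmode L n t)^`()%classic =
    fun x => om * (expR (- (lam * t)) * cos (n%:R * (pi * x / L))).
  by apply/funext => x; rewrite derive1E (@derive_val _ _ _ _ _ _ _ (dx t x)).
have xxE t x : (eigenmode L n t)^`(2)%classic x = - lam * eigenmode L n t x.
  by rewrite derive1nS derive1n1 xE derive1E (@derive_val _ _ _ _ _ _ _ (dxx t x)).
have lam0 : 0 <= lam by exact: sqr_ge0.
split.
- by move=> t x _ _; exact: (@ex_derive _ _ _ _ _ _ _ (dt t x)).
- by move=> t x _ _; exact: (@ex_derive _ _ _ _ _ _ _ (dx t x)).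
- by move=> t x _ _; rewrite xE; exact: (@ex_derive _ _ _ _ _ _ _ (dxx t x)).
- move=> t x _ _; rewrite (_ : (fun p : R * R => (eigenmode L n ^~ p.2)^`()%classic p.1) =
      (fun p => - lam * eigenmode L n p.1 p.2)); last by apply/funext => p; exact: tE.
  exact: (@eigenmode_continuous _ L (- lam) n sin (@continuous_sin R)).
- move=> t x _ _; rewrite (_ : (fun p : R * R => (eigenmode L n p.1)^`()%classic p.2) =
      (fun p => om * (expR (- (lam * p.1)) * cos (n%:R * (pi * p.2 / L))))); last first.
    by apply/funext => p; rewrite xE.
  exact: (@eigenmode_continuous _ L om n cos (@continuous_cos R)).
- move=> t x _ _; rewrite (_ : (fun p : R * R => (eigenmode L n p.1)^`(2)%classic p.2) =
      (fun p => - lam * eigenmode L n p.1 p.2)); last by apply/funext => p; exact: xxE.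
  exact: (@eigenmode_continuous _ L (- lam) n sin (@continuous_sin R)).
- by move=> t x _ _; rewrite tE xxE.
- apply: continuous_subspaceT => p.
  have := @eigenmode_continuous _ L 1 n sin (@continuous_sin R) p.
  by under eq_fun do rewrite mul1r.
- move=> t _; split; rewrite /eigenmode.
    by rewrite mulr0 mul0r mulr0 sin0 mulr0.
  rewrite mulfK ?gt_eqF// mulr_natl -[pi *+ _]add0r (alternatingn (@sinDpi R)).
  by rewrite sin0 mulr0 mulr0.
- have u0c : continuous (eigenmode L n 0).
    move=> x; apply: cvgM; first exact: cvg_cst.
    apply: continuous_cvg; first exact: continuous_sin.
    apply: cvgM; first exact: cvg_cst.
    by apply: cvgM; [apply: cvgM; [exact: cvg_cst|exact: cvg_id]|exact: cvg_cst].
  apply/andP; split; rewrite inE /=.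
    apply/(measurable_restrictT _ _).1; first exact: measurable_itv.
    by apply: measurable_funTS; exact: continuous_measurable_fun.
  apply: (@le_lt_trans _ _ (1 * Num.sqrt L)%:E); last exact: ltry.
  apply: L2norm_le_sup => // x _.
  by rewrite /eigenmode mulr0 oppr0 expR0 mul1r sin_max.
apply: (@squeeze_cvge _ _ _ _ (cst 0%E) _ (fun t => ((1 - expR (- (lam * t))) * Num.sqrt L)%:E)).
- near=> t; apply/andP; split; first exact: Lnorm_ge0.
  have t0 : 0 <= t by near: t; exact: nbhs_right_ge.
  have e1 : expR (- (lam * t)) <= 1 by rewrite expR_le1 oppr_le0 mulr_ge0.
  apply: L2norm_le_sup => //; first by rewrite subr_ge0.
  move=> x _; rewrite /= /eigenmode mulr0 oppr0 expR0 -mulrBl normrM.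
  rewrite (_ : `|_ - 1| = 1 - expR (- (lam * t))); last by rewrite distrC ger0_norm ?subr_ge0.
  by rewrite ler_piMr ?subr_ge0// sin_max.
- exact: cvg_cst.
apply/fine_cvgP; split; first by near=> t.
apply: cvg_within_filter.
have : (1 - expR (- (lam * t))) * Num.sqrt L @[t --> (0 : R)] -->
    (1 - expR (- (lam * 0))) * Num.sqrt L.
  apply: cvgM; last exact: cvg_cst.
  apply: cvgB; first exact: cvg_cst.
  apply: continuous_cvg; first exact: continuous_expR.
  by apply: cvgN; apply: cvgM; [exact: cvg_cst|exact: cvg_id].
by rewrite mulr0 oppr0 expR0 subrr mul0r.
Unshelve. all: by end_near. Qed.

Lemma sin_sub_le (R : realType) (x y : R) : `|sin x - sin y| <= `|x - y|.
Proof.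
wlog : x y / y <= x => [H|].
  have [|/ltW xy] := leP y x; first exact: H.
  by rewrite distrC [leRHS]distrC; exact: H.
rewrite le_eqVlt => /predU1P[->|yx]; first by rewrite !subrr.
have [|c _ ->] := @MVT R sin cos y x yx.
  by apply: continuous_subspaceT => z; exact: continuous_sin.
by rewrite normrM ler_piMl// cos_max.
Qed.

(** Only the first arch of the sine is kept, where the sine is at least [sin (pi / 4)] on the middle
    half. The loss of a factor [n^(1/2)] is harmless against the exponentials. *)
Lemma L2norm_eigenmode_ge (R : realType) (L t : R) (n : nat) : 0 < L -> (0 < n)%N ->
  ((expR (- (heat_eigenvalue L n * t)) * sin (pi / 4) * Num.sqrt (L / (2 * n%:R)))%:E <=
    L2norm L (eigenmode L n t))%E.
Proof.
move=> L0 n0; have pi0 := pi_gt0 R; have nR : 0 < n%:R :> R by rewrite ltr0n.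
have n1 : 1 <= n%:R :> R by rewrite ler1n.
set e := expR _; have e0 : 0 <= e by exact: expR_ge0.
have sig0 : 0 <= sin (pi / 4) :> R by apply: sin_ge0_pi; apply/andP; split; lra.
rewrite /L2norm Lnorm.unlock /=.
pose w : R -> R := eigenmode L n t \_ `]0, L[; rewrite -/w.
pose I : set R := `[(L / (4 * n%:R)), (3 * (L / (4 * n%:R)))]%classic.
pose q := L / (4 * n%:R).
have q0 : 0 < q by rewrite divr_gt0// mulr_gt0.
have qL : 4 * q <= L.
  rewrite /q invfM mulrA mulrCA mulrA; move: (n%:R) nR n1 => m m0 m1.
  by rewrite ler_pdivrMr//; have := ler_wpM2l (ltW L0) m1; lra.
have H : (((e * sin (pi / 4)) ^+ 2 * (L / (2 * n%:R)))%:E <=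
    \int[lebesgue_measure]_x `|(w x)%:E| `^ 2)%E.
  have := @ge0_integral_ge_steps R setT (fun x => `|(w x)%:E| `^ 2)%E [:: 0%N] (fun i => if i is 0%N then I else set0)
    (fun=> (e * sin (pi / 4)) ^+ 2) measurableT isT.
  rewrite big_seq1.
  have -> : lebesgue_measure I = (L / (2 * n%:R))%:E.
    rewrite /I -/q lebesgue_measure_itv/= lte_fin.
    have -> : q < 3 * q by lra.
    rewrite -EFinB; congr EFin; rewrite /q; field; rewrite gt_eqF//.
  rewrite -EFinM; apply.
  - by case=> [|?]; [exact: measurable_itv|exact: measurable0].
  - by move=> _; rewrite exprn_ge0// mulr_ge0.
  - by [].
  - by case=> [|?] [|?].
  - by move=> x _; exact: poweR_ge0.
  move=> i x; rewrite inE => /eqP ->; rewrite /I -/q /= in_itv/= => /andP[qx xq].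
  have x0L : x \in `]0, L[%classic by rewrite inE/= in_itv/=; apply/andP; split; lra.
  rewrite /w patchE x0L lee_fin powR_mulrn// lerXn2r ?nnegrE ?mulr_ge0//.
  rewrite /eigenmode -/e normrM ger0_norm// ler_wpM2l//.
  apply: le_trans (ler_norm _); apply: sin_le_middle; first by lra.
  have qE : n%:R * (pi * q / L) = pi / 4.
    by rewrite /q; move: (pi : R) => p; field; rewrite !gt_eqF.
  have mono (y z : R) : y <= z -> n%:R * (pi * y / L) <= n%:R * (pi * z / L).
    by move=> yz; rewrite ler_wpM2l ?(ltW nR)// ler_wpM2r ?invr_ge0 ?(ltW L0)// ler_wpM2l// ltW.
  apply/andP; split; first by rewrite -qE; exact: mono.
  rewrite (_ : pi - pi / 4 = n%:R * (pi * (3 * q) / L)); first exact: mono.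
  by rewrite /q; move: (pi : R) => p; field; rewrite !gt_eqF.
apply: (@le_trans _ _ (((e * sin (pi / 4)) ^+ 2 * (L / (2 * n%:R)))%:E `^ 2^-1)%E); last first.
  apply: gt0_ler_poweR => //; rewrite in_itv/= leey andbT.
    by rewrite lee_fin mulr_ge0 ?exprn_ge0 ?divr_ge0 ?mulr_ge0 ?(ltW L0).
  by apply: integral_ge0 => x _; rewrite lee_fin powR_ge0.
rewrite poweR_EFin lee_fin powR12_sqrt; last first.
  by rewrite mulr_ge0 ?exprn_ge0 ?divr_ge0 ?mulr_ge0 ?(ltW L0).
by rewrite [leRHS]sqrtrM ?exprn_ge0 ?mulr_ge0// sqrtr_sqr ger0_norm ?mulr_ge0.
Qed.

(** The sine of frequency [N k] vanishes on the lattice of step [L / N k], and sine is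
    1-Lipschitz. *)
Lemma eigenmode_integral_le (R : realType) (L eps T : R) (N : nat -> nat) (k : nat) :
  0 < L -> 0 < T -> thin_set L eps N !=set0 -> (0 < N k)%N ->
  (\int[lebesgue_measure]_(t in `]0%R, T[)
     ereal_sup [set `|eigenmode L (N k) t x|%:E | x in thin_set L eps N] <=
   ((N k)%:R * pi / L * cell_radius eps (N k) * T)%:E)%E.
Proof.
move=> L0 T0 E0 Nk0; have pi0 := pi_gt0 R.
have NR : 0 < (N k)%:R :> R by rewrite ltr0n.
set b := _ * cell_radius _ _.
apply: (@le_trans _ _ (\int[lebesgue_measure]_(t in `]0%R, T[) (cst b%:E) t)%E); last first.
  by rewrite integral_cst//= lebesgue_measure_itv/= lte_fin T0 oppr0 adde0 EFinM.
apply: ge0_integral_le_lower => t; rewrite /= in_itv/= => /andP[t0 _].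
  exact: ereal_sup_abs_ge0.
apply: ge_ereal_sup => _ [x [xL Ex] <-]; rewrite lee_fin.
have [m xm] := Ex k.
rewrite /eigenmode normrM -[leRHS]mul1r; apply: ler_pM => //.
  rewrite ger0_norm ?expR_ge0// expR_le1 oppr_le0 mulr_ge0 ?sqr_ge0 ?ltW//.
pose y := m%:R * (L / (N k)%:R).
have sy : sin ((N k)%:R * (pi * y / L)) = 0.
  rewrite (_ : _ * _ = 0 + pi *+ m).
    by rewrite (alternatingn (@sinDpi R)) sin0 mulr0.
  rewrite add0r -[RHS]mulr_natl /y; move: (pi : R) => p; field.
  by rewrite !gt_eqF.
rewrite -[sin _]subr0 -sy; apply: le_trans (sin_sub_le _ _) _.
rewrite (_ : _ - _ = (N k)%:R * pi / L * (x - y)); last by field; rewrite gt_eqF.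
rewrite normrM ger0_norm ?divr_ge0 ?mulr_ge0 ?(ltW pi0) ?(ltW L0)//.
by rewrite ler_wpM2l// divr_ge0 ?mulr_ge0 ?(ltW pi0) ?(ltW L0).
Qed.

Lemma observability_fails (R : realType) (L eps : R) (f : R -> R) :
  0 < L -> 0 < eps -> gauge_extension (f_formula eps) f ->
  exists E : set R,
    [/\ E `<=` `]0, L[, (0 < hausdorff_content f E)%E &
        forall T : R, 0 < T -> ~ exists C : R, observability L T E C].
Proof.
move=> L0 e0 fext; have [gf _ _] := fext; have pi0 := pi_gt0 R.
have [N0 E_gt0] := thin_set_content_gt0 L0 e0 fext.
set E := thin_set _ _ _ in E_gt0; exists E; split=> //.
  by move=> x [xL _]; rewrite /= in_itv.
move=> T T0 [C obs]; have E_neq0 := content_gt0_nonempty gf E_gt0.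
pose sigma : R := sin (pi / 4).
have sigma0 : 0 < sigma by apply: sin_gt0_pi; apply/andP; split; lra.
pose D := `|C| * (pi / L) * T / sigma.
have D0 : 0 <= D.
  by rewrite divr_ge0 ?mulr_ge0 ?invr_ge0 ?(ltW pi0) ?(ltW L0) ?(ltW T0) ?(ltW sigma0).
pose S := Num.sqrt (2 / L); have S0 : 0 < S by rewrite sqrtr_gt0 divr_gt0.
(* Since [n^p = n^2 n^(eps/2)], this makes [n^p] minus the heat exponent at least [n^2 (1 + D S)],
   which beats the factor [n^(3/2)] left by the Lipschitz constant and the norm. *)
have [M HM] := @powR_eventually_ge R ((pi / L) ^+ 2 * T + 1 + D * S) (eps / 2) ltac:(by rewrite divr_gt0).
pose n := frequencies eps N0 M.+1.
have nM : (M.+1 <= n)%N by apply: leq_trans (frequencies_ge N0 M.+1 e0); rewrite leq_addl.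
have n0 : (0 < n)%N by exact: leq_trans nM.
have nR : 0 < n%:R :> R by rewrite ltr0n.
have n1 : 1 <= n%:R :> R by rewrite ler1n.
have := obs _ (eigenmode_solution n L0); apply/negP; rewrite -ltNge.
apply: (@lt_le_trans _ _ (expR (- (heat_eigenvalue L n * T)) * sigma *
    Num.sqrt (L / (2 * n%:R)))%:E); last exact: L2norm_eigenmode_ge.
apply: (@le_lt_trans _ _ (`|C|%:E * (n%:R * pi / L * cell_radius eps n * T)%:E)%E).
  apply: (@le_trans _ _ (`|C|%:E * \int[lebesgue_measure]_(t in `]0%R, T[)
     ereal_sup [set `|eigenmode L n t x|%:E | x in E])%E).
    apply: lee_wpmul2r; last by rewrite lee_fin ler_norm.
    by apply: integral_ge0 => t _; exact: ereal_sup_abs_ge0.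
  apply: lee_wpmul2l; first by rewrite lee_fin.
  exact: (@eigenmode_integral_le _ L eps T (frequencies eps N0) M.+1).
rewrite -EFinM lte_fin.
have -> : Num.sqrt (L / (2 * n%:R)) = (S * Num.sqrt n%:R)^-1.
  rewrite /S -sqrtrM ?divr_ge0 ?(ltW L0)// -sqrtrV; last by rewrite mulr_ge0 ?divr_ge0 ?(ltW L0).
  by congr Num.sqrt; field; rewrite !gt_eqF.
have sq0 : 0 < Num.sqrt n%:R :> R by rewrite sqrtr_gt0.
have sqn : Num.sqrt n%:R <= n%:R :> R.
  rewrite -[leRHS]sqr_sqrtr// expr2 ler_peMr ?(ltW sq0)//.
  by rewrite -[leLHS]sqrtr1 ler_sqrt.
rewrite ltr_pdivlMr ?mulr_gt0//.
rewrite (_ : `|C| * _ * _ = D * S * (n%:R * Num.sqrt n%:R) * cell_radius eps n * sigma); last first.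
  by rewrite /D; move: (pi : R) => p; field; rewrite !gt_eqF.
rewrite ltr_pM2r// /cell_radius.
have expE : expR (- (heat_eigenvalue L n * T)) =
    expR (n%:R `^ (2 + eps / 2) - heat_eigenvalue L n * T) * expR (- (n%:R `^ (2 + eps / 2))).
  by rewrite -expRD; congr expR; ring.
rewrite expE ltr_pM2r ?expR_gt0//.
apply: (@le_lt_trans _ _ (D * S * n%:R ^+ 2)).
  have DS0 : 0 <= D * S by exact: mulr_ge0 D0 (ltW S0).
  by apply: ler_wpM2l => //; rewrite expr2 ler_wpM2l// ltW.
have nn0 : 0 < n%:R ^+ 2 :> R by rewrite exprn_gt0.
have powE : n%:R `^ (2 + eps / 2) = n%:R ^+ 2 * n%:R `^ (eps / 2) :> R.
  by rewrite powRD ?powR_mulrn// (gt_eqF nR) implybT.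
have powge : n%:R ^+ 2 * ((pi / L) ^+ 2 * T + 1 + D * S) <= n%:R `^ (2 + eps / 2).
  by rewrite powE ler_wpM2l ?(ltW nn0)// HM// ltnW.
have eigE : heat_eigenvalue L n * T = n%:R ^+ 2 * ((pi / L) ^+ 2 * T).
  by rewrite /heat_eigenvalue; move: (pi : R) (L^-1) => p q; ring.
apply: lt_le_trans (expR_ge1Dx _); rewrite eigE.
apply: (@lt_le_trans _ _ (1 + n%:R ^+ 2 * (1 + D * S))); last by lra.
by rewrite mulrDr mulr1 [n%:R ^+ 2 * _]mulrC; lra.
Qed.

Theorem theorem2p1 (R : realType) (L : R) (hL : 0 < L) :
  (forall (alpha : R) (h : R -> R), 3 / 2 < alpha ->
     gauge_extension (h_formula alpha) h ->
     forall (T : R) (c : \bar R), 0 < T -> (0 < c)%E ->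
     exists C : R, 0 < C /\
       forall E : set R, E `<=` `]0, L[ -> hausdorff_content h E = c ->
         observability L T E C)
  /\
  (forall (eps : R) (f : R -> R), 0 < eps ->
     gauge_extension (f_formula eps) f ->
     exists E : set R,
       [/\ E `<=` `]0, L[,
           (0 < hausdorff_content f E)%E &
           forall T : R, 0 < T -> ~ exists C : R, observability L T E C]).
Proof.
split; first by move=> alpha h a32 hext; exact: (observability_of_content hL a32 hext).
by move=> eps f e0 fext; exact: (observability_fails hL e0 fext).
Qed.
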